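(* Let $\{F(t):t\in\mathbb R^d\}$ be a stochastic process with continuous sample paths, $F(t)>0$ for all $t\in\mathbb R^d$, and $\mathbb E\int_{\mathbb R^d}F(t)\,dt=1$. Let $M(t)=\max_{i\in\mathbb N}U_iF_i(t-T_i)$, $t\in\mathbb R^d$, where $\sum_i\delta_{(U_i,T_i,F_i)}$ is a Poisson point process on $(0,\infty)\times\mathbb R^d\times C(\mathbb R^d)$ with intensity $u^{-2}du\,dt\,\mathbb P_F(df)$. Define a probability law of a random process $W$ with values in $C^+(\mathbb R^d)$ by $$\mathbb P(W\in L)=\int_{C^+(\mathbb R^d)}\int_{\mathbb R^d}\mathbf 1_{\{f(\cdot-t)/f(-t)\in L\}}\,f(-t)\,dt\,\mathbb P_F(df),\qquad L\in\mathcal B(C^+(\mathbb R^d)).$$ Then $W(\mathbf 0)=1$ and $$\{M(t)\}_{t\in\mathbb R^d}\overset{d}{=}\Big\{\max_{i\in\mathbb N}U'_iW_i(t)\Big\}_{t\in\mathbb R^d},$$ where $\sum_i\delta_{U'_i}$ is a Poisson point process on $(0,\infty)$ with intensity $u^{-2}du$ and $W_i$ are i.i.d. copies of $W$ independent of it; i.e. $M$ admits an incremental representation with $t_0=\mathbf 0$ and incremental process $W$.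
   Context: $C(\mathbb R^d)$ and $C^+(\mathbb R^d)$ are the spaces of non-negative, resp. strictly positive, continuous functions on $\mathbb R^d$ with the topology of uniform convergence on compact sets. *)

(* Defs.v *)
From HB Require Import structures.
From mathcomp Require Import all_boot all_order all_algebra.
From mathcomp Require Import all_classical all_reals all_analysis measurable_realfun.
Set Implicit Arguments. Unset Strict Implicit. Unset Printing Implicit Defensive.
Import Order.TTheory GRing.Theory Num.Theory.
Import numFieldNormedType.Exports.
Local Open Scope classical_set_scope.
Local Open Scope ring_scope.

Definition Rd_meas (R : realType) (d : nat) : set (set 'rV[R]_d) :=
  <<s [set A | exists (j : 'I_d) (B : set R),
                 measurable B /\ A = [set x : 'rV[R]_d | B (x ord0 j)]] >>.

(* Cylinder (product) sigma-algebra on I -> T, generated by the evaluations.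
   For I = 'rV[R]_d and T = R its trace on C(R^d) is the Borel sigma-algebra of
   the topology of uniform convergence on compact sets. *)
Definition cyl_meas (I : Type) (dT : measure_display) (T : measurableType dT)
  : set (set (I -> T)) :=
  <<s [set A | exists (i : I) (B : set T),
                 measurable B /\ A = [set f | B (f i)]] >>.

(* Product sigma-algebra on (0,oo) x R^d x C(R^d) (points represented in
   R * 'rV[R]_d * ('rV[R]_d -> R)). *)
Definition mark_meas (R : realType) (d : nat)
  : set (set (R * 'rV[R]_d * ('rV[R]_d -> R))) :=
  <<s [set A | (exists B : set R, measurable B /\ A = [set x | B x.1.1])
            \/ (exists C, Rd_meas C /\ A = [set x | C x.1.2])
            \/ (exists D, cyl_meas D /\ A = [set x | D x.2])] >>.

Definition ord_cons (R : realType) (n : nat) (x : R) (v : 'I_n -> R)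
  : 'I_n.+1 -> R :=
  fun i => if unlift ord0 i is Some j then v j else x.

(* iterated one-dimensional Lebesgue integrals; for nonnegative measurable
   integrands this is the integral w.r.t. Lebesgue measure on R^n (Tonelli) *)
Fixpoint iter_int (R : realType) (n : nat) : (('I_n -> R) -> \bar R) -> \bar R :=
  match n with
  | 0 => fun g => g (fun _ => 0)
  | n'.+1 => fun g =>
      (\int[@lebesgue_measure R]_x iter_int (fun v => g (ord_cons x v)))%E
  end.

Definition int_Rd (R : realType) (d : nat) (g : 'rV[R]_d -> \bar R) : \bar R :=
  iter_int (fun v : 'I_d -> R => g (\row_j v j)).

Definition poisson_mass (R : realType) (lam : R) (k : nat) : R :=
  lam ^+ k / k`!%:R * expR (- lam).

Definition pcount (T E : Type) (R : realType) (X : nat -> T -> E) (A : set E)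
  (w : T) : \bar R :=
  (\esum_(i in [set i | A (X i w)]) (1%E : \bar R))%R.

Definition is_PPP (R : realType) (d0 : measure_display) (T : measurableType d0)
  (P : probability T R) (E : Type) (SE : set (set E)) (Lam : set E -> \bar R)
  (X : nat -> T -> E) : Prop :=
  [/\ (forall i A, SE A -> measurable (X i @^-1` A)),
      (forall A, SE A -> forall k : nat, Lam A < +oo ->
          P [set w | pcount R X A w = k%:R%:E] =
          (poisson_mass (fine (Lam A)) k)%:E)%E,
      (forall A, SE A -> Lam A = +oo ->
          P [set w | pcount R X A w = +oo] = 1)%E &
      (forall (n : nat) (A : 'I_n -> set E) (B : 'I_n -> set (\bar R)),
          (forall j, SE (A j)) ->
          (forall j k, j != k -> A j `&` A k = set0) ->
          (forall j, measurable (B j)) ->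
          P (\bigcap_(j in [set: 'I_n]) [set w | B j (pcount R X (A j) w)]) =
          (\prod_(j < n) P [set w | B j (pcount R X (A j) w)])%E)].

(* intensity u^-2 du dt P_F(df) on (0,oo) x R^d x C(R^d); the P_F(df)-integral
   is written as an expectation in F *)
Definition mark_intensity (R : realType) (d : nat) (d0 : measure_display)
  (T : measurableType d0) (P : probability T R) (F : T -> 'rV[R]_d -> R)
  (A : set (R * 'rV[R]_d * ('rV[R]_d -> R))) : \bar R :=
  (\int[@lebesgue_measure R]_(u in [set u : R | (0 < u)%R])
     ((u ^- 2)%:E *
      int_Rd (fun t => \int[P]_w (\1_A (u, t, F w))%:E)))%E.

Definition radial_intensity (R : realType) (A : set R) : \bar R :=
  (\int[@lebesgue_measure R]_(u in [set u : R | (0 < u)%R]) ((u ^- 2)%:E * (\1_A u)%:E))%E.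

Definition W_law (R : realType) (d : nat) (d0 : measure_display)
  (T : measurableType d0) (P : probability T R) (F : T -> 'rV[R]_d -> R)
  (L : set ('rV[R]_d -> R)) : \bar R :=
  (\int[P]_w int_Rd (fun t =>
      (\1_L (fun s => F w (s - t) / F w (- t)))%:E * (F w (- t))%:E))%E.

Definition mixed_max (R : realType) (d : nat) (T : Type)
  (X : nat -> T -> R * 'rV[R]_d * ('rV[R]_d -> R)) (w : T) (t : 'rV[R]_d)
  : \bar R :=
  ereal_sup (range (fun i => ((X i w).1.1 * (X i w).2 (t - (X i w).1.2))%:E)).

Definition incr_max (R : realType) (d : nat) (T : Type) (U : nat -> T -> R)
  (W : nat -> T -> 'rV[R]_d -> R) (w : T) (t : 'rV[R]_d) : \bar R :=
  ereal_sup (range (fun i => (U i w * W i w t)%:E)).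

Definition same_fdd (R : realType) (d : nat)
  (d1 : measure_display) (T1 : measurableType d1) (P1 : probability T1 R)
  (X1 : T1 -> 'rV[R]_d -> \bar R)
  (d2 : measure_display) (T2 : measurableType d2) (P2 : probability T2 R)
  (X2 : T2 -> 'rV[R]_d -> \bar R) : Prop :=
  forall (n : nat) (ts : 'I_n -> 'rV[R]_d) (B : set ('I_n -> \bar R)),
    cyl_meas B ->
    P1 [set w | B (fun j => X1 w (ts j))] = P2 [set w | B (fun j => X2 w (ts j))].

(* Main.v *)
Require Import Defs.
From HB Require Import structures.
From mathcomp Require Import all_boot all_order all_algebra.
From mathcomp Require Import all_classical all_reals all_analysis measurable_realfun.
Set Implicit Arguments. Unset Strict Implicit. Unset Printing Implicit Defensive.
Import Order.TTheory GRing.Theory Num.Theory.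
Import numFieldNormedType.Exports.
Local Open Scope classical_set_scope.
Local Open Scope ring_scope.

(** Both processes have joint distribution functions given by void
    probabilities: [M(t_j) <= x_j] for all [j] says that the marked Poisson
    process has no point [(u, s, f)] with [u f(t_j - s) > x_j] for some [j], an
    event of probability [exp (- Lambda)]. By Tonelli and the substitution
    [v = u f(- s)], which turns [u^-2 du] into [f(- s) v^-2 dv], [Lambda] is the
    integral of [v^-2 P(v W(t_j) > x_j for some j) dv]. For the incremental
    representation the same exponent comes from thinning: replacing the radii
    [U'_i] by simple functions of them, the number of radii in each level set
    is Poisson and the counts are independent, so averaging over the marks
    gives a product of Poisson generating functions; monotone approximation of
    the identity by simple functions removes the discretization. *)

(** * Product sigma-algebras *)

(** A Poisson process is specified here by its counts on measurable sets, and the pairs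
    [(U' i, W i)] are never shown to form such a process: only the probability that no pair exceeds
    is computed. As the marks are independent of the whole sequence of radii, the first [n] pairs
    avoid exceedance with probability the mean of a product of factors [c (kappa (U i))], which
    depends only on the counts per level set; then [n] tends to infinity under the mean. Since
    [u^-2] is not integrable at 0, one of the finitely many level sets always has infinite
    intensity, so counts equal to [+oo] cannot be avoided and powers must be defined there.
    Strictness of the exceedance inequalities governs the last limit: [x j < u * f (t j)] is open in
    [u], so replacing radii by smaller finite-valued ones gives exceedance events that increase to
    the exact one. The finite range also settles how the exceedance probability depends measurably
    on the radius. *)

Definition cyl_gen (I : Type) (dT : measure_display) (T : measurableType dT)
  : set (set (I -> T)) :=
  [set A | exists (i : I) (B : set T), measurable B /\ A = [set f | B (f i)]].
(** A copy of the function space whose measurable sets are [cyl_meas] by conversion, so that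
    cylinder sets can be handled as preimages under measurable maps. *)
Local Notation cylType I T := (g_sigma_algebraType (@cyl_gen I _ T)).

Definition row_gen (R : realType) (d : nat) : set (set 'rV[R]_d) :=
  [set A | exists (j : 'I_d) (B : set R),
     measurable B /\ A = [set x : 'rV[R]_d | B (x ord0 j)]].
Local Notation rowType R d := (g_sigma_algebraType (@row_gen R d)).

Section generated.
Context (I : Type) (dT dT' : measure_display) (T : measurableType dT)
  (T' : measurableType dT').

Lemma measurable_cylP (f : T -> I -> T') :
  (forall i, measurable_fun setT (f ^~ i)) ->
  measurable_fun setT (f : T -> cylType I T').
Proof.
move=> mf; apply: (@measurability _ _ T (cylType I T') _ _ (@cyl_gen I _ T')) => //.
move=> _ [_ [i [B [mB ->]]] <-]; rewrite setTI.
by have := mf i measurableT _ mB; rewrite setTI.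
Qed.

Lemma measurable_eval (i : I) :
  measurable_fun setT (fun f : cylType I T' => f i).
Proof.
move=> _ B mB; rewrite setTI; apply: sub_sigma_algebra.
by exists i, B.
Qed.

End generated.

Lemma measurable_rowP (R : realType) (d : nat) dT (T : measurableType dT)
    (f : T -> 'rV[R]_d) :
  (forall j, measurable_fun setT (fun x => f x ord0 j)) ->
  measurable_fun setT (f : T -> rowType R d).
Proof.
move=> mf; apply: (@measurability _ _ T (rowType R d) _ _ (@row_gen R d)) => //.
move=> _ [_ [j [B [mB ->]]] <-]; rewrite setTI.
by have := mf j measurableT _ mB; rewrite setTI.
Qed.

Lemma measurable_coord (R : realType) (d : nat) (j : 'I_d) :
  measurable_fun setT (fun x : rowType R d => x ord0 j).
Proof.
move=> _ B mB; rewrite setTI; apply: sub_sigma_algebra.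
by exists j, B.
Qed.

Lemma measurable_rowB (R : realType) (d : nat) (t : 'rV[R]_d) :
  measurable_fun setT (fun s : rowType R d => (t - s : rowType R d)).
Proof.
apply: measurable_rowP => j.
under eq_fun do rewrite mxE mxE.
by apply: measurable_funB => //; exact: measurable_coord.
Qed.

Lemma measurable_row_of_fun (R : realType) (d : nat) :
  measurable_fun setT
    (fun v : cylType 'I_d R => ((\row_j v j)%R : rowType R d)).
Proof.
apply: measurable_rowP => j; apply: (eq_measurable_fun (fun v : cylType 'I_d R => v j)).
  by move=> v _; rewrite mxE.
exact: measurable_eval.
Qed.

(** Membership in [mark_meas] is reduced to measurability in a binary product, where maps can be
    composed: the identity from the space carrying [mark_meas] is measurable because its three
    components are. *)
Lemma mark_measP (R : realType) (d : nat)
    (A : set (R * rowType R d * cylType 'rV[R]_d R)) :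
  measurable A -> mark_meas A.
Proof.
move=> mA.
pose M := g_sigma_algebraType (@mark_meas R d).
have sM : forall B : set M, @mark_meas R d B -> measurable B.
  by move=> B mB; exact: sub_sigma_algebra.
have MI : measurable_fun setT
    (fun x : M => (x : R * rowType R d * cylType 'rV[R]_d R)).
  have -> : (fun x : M => (x : R * rowType R d * cylType 'rV[R]_d R)) =
      (fun x : M => ((x.1.1, x.1.2), x.2)).
    by apply/funext => -[[]].
  apply: measurable_fun_pair; first apply: measurable_fun_pair.
  - move=> _ B mB; rewrite setTI; apply: sM; apply: sub_sigma_algebra; left.
    by exists B.
  - move=> _ B mB; rewrite setTI; apply: sM; apply: sub_sigma_algebra; right; left.
    by exists B.
  - move=> _ B mB; rewrite setTI; apply: sM; apply: sub_sigma_algebra; right; right.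
    by exists B.
(* The structure on [M] is the sigma-algebra generated by [mark_meas], which is already a
   sigma-algebra. *)
have := MI measurableT _ mA; rewrite setTI /measurable/=.
by rewrite sigma_algebra_id //; exact: smallest_sigma_algebra.
Qed.

(** * Evaluation of random continuous functions *)

Section grid.
Context (R : realType) (d : nat).
Implicit Types y : 'rV[R]_d.

(** Index of the cell of mesh [1 / n.+1] that contains [y]; the successor keeps the mesh defined at
    [n = 0]. What matters is that the cells are countably many. *)
Definition grid_index (n : nat) y : 'rV[int]_d :=
  \row_j Num.floor (n.+1%:R * y ord0 j).

Definition grid_point (n : nat) (k : 'rV[int]_d) : 'rV[R]_d :=
  \row_j ((k ord0 j)%:~R / n.+1%:R).

Lemma grid_point_cvg y : (grid_point n (grid_index n y)) @[n --> \oo] --> y.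
Proof.
apply/cvg_ballP => e e0.
near=> n; split => // i j; rewrite ord1 !mxE.
have n0 : (0 : R) < n.+1%:R by rewrite ltr0n.
rewrite /ball/= -[X in X - _](mulKf (lt0r_neq0 n0)) mulrC -mulrBl normrM.
rewrite (@ger0_norm _ (n.+1%:R^-1)) ?invr_ge0 ?(ltW n0)//.
rewrite ltr_pdivrMr// (@le_lt_trans _ _ 1)//.
  have /andP[lo hi] := floor_itv (n.+1%:R * y ord0 j).
  rewrite ger0_norm ?subr_ge0// lerBlDl ltW//.
  by rewrite (lt_le_trans hi)// intrD.
rewrite -ltr_pdivrMl// mulr1.
near: n; have := near_infty_natSinv_lt (PosNum e0).
apply: filterS => n /=.
by move=> ne; rewrite -(invrK n.+1%:R) ltf_pV2 ?posrE ?invr_gt0 ?ltr0n.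
Unshelve. all: by end_near. Qed.

Lemma measurable_grid_index n (k : 'rV[int]_d) :
  measurable [set y : rowType R d | grid_index n y = k].
Proof.
have -> : [set y : rowType R d | grid_index n y = k] =
    \bigcap_(j in [set: 'I_d])
      [set y : rowType R d | `[(k ord0 j)%:~R, (k ord0 j + 1)%:~R[%classic
                               (n.+1%:R * y ord0 j)].
  apply/seteqP; split => y /= H.
    by move=> j _; rewrite /= in_itv/= -H mxE floor_itv.
  apply/rowP => j; rewrite mxE; apply: floor_def.
  by have := H j I; rewrite /= in_itv.
apply: fin_bigcap_measurable => // j _.
have mf : measurable_fun setT (fun y : rowType R d => n.+1%:R * y ord0 j).
  by apply: measurable_funM => //; exact: measurable_coord.
have := mf measurableT _ (measurable_itv `[(k ord0 j)%:~R, (k ord0 j + 1)%:~R[).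
by rewrite setTI.
Qed.

(* On all functions [f], [f y] is not jointly measurable in [(f, y)] for the
   product sigma-algebra; this upper limit is. *)
Definition grid_eval (f : 'rV[R]_d -> R) y : \bar R :=
  limn_esup (fun n => (f (grid_point n (grid_index n y)))%:E).

Lemma grid_eval_continuous (f : 'rV[R]_d -> R) y :
  continuous f -> grid_eval f y = (f y)%:E.
Proof.
move=> cf.
have fy : (f (grid_point n (grid_index n y)))%:E @[n --> \oo] --> (f y)%:E.
  apply: cvg_EFin; first exact: nearW.
  by apply: continuous_cvg; [exact: cf|exact: grid_point_cvg].
rewrite /grid_eval is_cvg_limn_esupE; first exact/cvg_lim.
by apply/cvg_ex; exists (f y)%:E.
Qed.

Context (dT : measure_display) (T : measurableType dT).
Variables (f : T -> 'rV[R]_d -> R) (g : T -> 'rV[R]_d).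
Hypotheses (mf : measurable_fun setT (f : T -> cylType 'rV[R]_d R))
           (mg : measurable_fun setT (g : T -> rowType R d)).

(** On the event that [g] lies in a given cell, evaluation at a random point becomes evaluation at a
    fixed lattice point, which is measurable for cylinder sets; countably many cells cover
    everything. *)
Lemma measurable_grid_eval : measurable_fun setT (fun w => grid_eval (f w) (g w)).
Proof.
apply: measurable_fun_limn_esup => n; apply/measurable_EFinP.
move=> _ B mB; rewrite setTI.
rewrite [X in measurable X](_ : _ = \bigcup_(k : 'rV[int]_d)
    (g @^-1` [set y : rowType R d | grid_index n y = k] `&`
     f @^-1` [set h : cylType 'rV[R]_d R | B (h (grid_point n k))])); last first.
  apply/seteqP; split => [w Bw|w [k _ [/= gk Bw]]] /=; last by rewrite gk.
  by exists (grid_index n (g w)).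
apply: countable_bigcupT_measurable; first exact: countableP.
move=> k; apply: measurableI.
  by have := mg measurableT (measurable_grid_index n k); rewrite setTI.
have := measurable_eval (T' := R) (grid_point n k) measurableT mB.
by rewrite setTI => /(mf measurableT); rewrite setTI.
Qed.

Lemma measurable_random_eval :
  (forall w, continuous (f w)) -> measurable_fun setT (fun w => f w (g w)).
Proof.
move=> cf; apply/measurable_EFinP.
apply: (eq_measurable_fun (fun w => grid_eval (f w) (g w))).
  by move=> w _; rewrite grid_eval_continuous.
exact: measurable_grid_eval.
Qed.

End grid.

(** * Iterated Lebesgue integrals *)

Section iter_int_theory.
Local Open Scope ereal_scope.
Context (R : realType).
Local Notation mu := (@lebesgue_measure R).

Lemma measurable_ord_cons n :
  measurable_fun setT
    (fun z : R * cylType 'I_n R => ord_cons z.1 z.2 : cylType 'I_n.+1 R).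
Proof.
apply: measurable_cylP => i; rewrite /ord_cons.
case: unliftP => [j _|_]; last exact: measurable_fst.
exact: (measurableT_comp (measurable_eval (T' := R) j) measurable_snd).
Qed.

Lemma measurable_pair_ord_cons n dT (T : measurableType dT) :
  measurable_fun setT (fun z : (T * R) * cylType 'I_n R =>
    (z.1.1, ord_cons z.1.2 z.2) : T * cylType 'I_n.+1 R).
Proof.
apply: measurable_fun_pair.
  exact: (measurableT_comp measurable_fst measurable_fst).
have mz : measurable_fun setT
    (fun z : (T * R) * cylType 'I_n R => (z.1.2, z.2)).
  apply: measurable_fun_pair => //.
  exact: (measurableT_comp measurable_snd measurable_fst).

exact: (measurableT_comp (@measurable_ord_cons n) mz).
Qed.

Lemma iter_int_ge0 n (g : ('I_n -> R) -> \bar R) :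
  (forall v, 0 <= g v) -> 0 <= iter_int g.
Proof.
by elim: n g => [|n IH] g g0 //=; apply: integral_ge0 => x _; exact: IH.
Qed.

Lemma measurable_section dT (T : measurableType dT) dT' (T' : measurableType dT')
    dU (U : measurableType dU) (g : T * T' -> U) (x : T) :
  measurable_fun setT g -> measurable_fun setT (fun y => g (x, y)).
Proof. by move=> mg; exact: (measurableT_comp mg (pair1_measurable _)). Qed.

(** The parameter space varies in the induction: the outermost integration variable joins the
    parameter, and Tonelli then integrates it out. *)
Lemma measurable_iter_int n dT (T : measurableType dT)
    (g : T * cylType 'I_n R -> \bar R) :
  measurable_fun setT g -> (forall z, 0 <= g z) ->
  measurable_fun setT (fun x => iter_int (fun v => g (x, v))).
Proof.
elim: n dT T g => [|n IH] dT T g mg g0 /=.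
  exact: (measurableT_comp mg (pair2_measurable _)).
apply: (@measurable_fun_fubini_tonelli_F _ _ _ _ _ mu
  (fun z => iter_int (fun v => g (z.1, ord_cons z.2 v)))).
  apply: (IH _ _ (fun z => g (z.1.1, ord_cons z.1.2 z.2))) => //.
  exact: (measurableT_comp mg (@measurable_pair_ord_cons n _ _)).
by move=> z; exact: iter_int_ge0.
Qed.

(** Tonelli moves the outer Lebesgue integral past [m]; with that coordinate frozen, the induction
    hypothesis moves the remaining ones. *)
Lemma iter_int_exchange n dT (T : measurableType dT)
    (m : {sigma_finite_measure set T -> \bar R})
    (g : T * cylType 'I_n R -> \bar R) :
  measurable_fun setT g -> (forall z, 0 <= g z) ->
  \int[m]_x iter_int (fun v => g (x, v)) =
  iter_int (fun v => \int[m]_x g (x, v)).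
Proof.
elim: n g => [//|n IH] g mg g0 /=.
pose h (z : T * R * cylType 'I_n R) := g (z.1.1, ord_cons z.1.2 z.2).
have mh : measurable_fun setT h.
  exact: (measurableT_comp mg (@measurable_pair_ord_cons n _ _)).
have mH : measurable_fun setT (fun z => iter_int (fun v => h (z, v))).
  by apply: measurable_iter_int => // z; exact: g0.
rewrite (@fubini_tonelli _ _ _ _ _ m mu
  (fun z => iter_int (fun v => h (z, v)))) //; last first.
  by move=> z; apply: iter_int_ge0 => v; exact: g0.
apply: eq_integral => y _; rewrite -(IH (fun z => h (z.1, y, z.2)))//.
- apply: (measurableT_comp mh); apply: measurable_fun_pair; last exact: measurable_snd.
  by apply: measurable_fun_pair => //; exact: measurable_fst.
- by move=> z; exact: g0.
Qed.

Lemma iter_intZl n (k : R) (g : cylType 'I_n R -> \bar R) : (0 <= k)%R ->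
  measurable_fun setT g -> (forall v, 0 <= g v) ->
  iter_int (fun v => k%:E * g v) = k%:E * iter_int g.
Proof.
move=> k0; elim: n g => [//|n IH] g mg g0 /=.
pose h (z : R * cylType 'I_n R) := g (ord_cons z.1 z.2).
have mh : measurable_fun setT h.
  exact: (measurableT_comp mg (@measurable_ord_cons n)).
rewrite -ge0_integralZl//.
- apply: eq_integral => x _; apply: (IH (fun v => h (x, v))) => //.
  + exact: measurable_section.
  + by move=> v; exact: g0.
- apply: (measurable_iter_int mh) => z; exact: g0.
- by move=> x _; apply: iter_int_ge0.
Qed.

Lemma ge0_integralN (f : R -> \bar R) : measurable_fun setT f ->
  (forall x, 0 <= f x) -> \int[mu]_x f (- x)%R = \int[mu]_x f x.
Proof.
move=> mf f0.
transitivity (\int[pushforward mu (-%R : _ -> measurableTypeR R)]_x f x).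
  by rewrite ge0_integral_pushforward.
by apply: eq_measure_integral => //= A mA _; exact: lebesgue_measureN.
Qed.

(** Serves to trade the weight [F w (- t)] in [W_law] for [F w t], whose integral is known. *)
Lemma ge0_iter_intN n (g : cylType 'I_n R -> \bar R) :
  measurable_fun setT g -> (forall v, 0 <= g v) ->
  iter_int (fun v => g (fun i => (- v i)%R)) = iter_int g.
Proof.
elim: n g => [|n IH] g mg g0 /=.
  by congr (g _); apply/funext => -[].
pose h (z : R * cylType 'I_n R) := g (ord_cons z.1 z.2).
have mh : measurable_fun setT h.
  exact: (measurableT_comp mg (@measurable_ord_cons n)).
rewrite -[RHS]ge0_integralN.
- apply: eq_integral => x _; rewrite -(IH (fun v => h ((- x)%R, v))).
  + congr iter_int; apply/funext => v; rewrite /h/=; congr g; apply/funext => i.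
    by rewrite /ord_cons; case: unliftP.
  + exact: measurable_section.
  + by move=> v; exact: g0.
- apply: (measurable_iter_int mh) => z; exact: g0.
- by move=> x; apply: iter_int_ge0.
Qed.

End iter_int_theory.

Section int_Rd_theory.
Local Open Scope ereal_scope.
Context (R : realType) (d : nat).

Lemma measurable_pair_row dT (T : measurableType dT) :
  measurable_fun setT (fun z : T * cylType 'I_d R =>
    (z.1, \row_j z.2 j) : T * rowType R d).
Proof.
apply: measurable_fun_pair; first exact: measurable_fst.
exact: (measurableT_comp (@measurable_row_of_fun R d) measurable_snd).
Qed.

Lemma int_Rd_exchange dT (T : measurableType dT)
    (m : {sigma_finite_measure set T -> \bar R})
    (g : T * rowType R d -> \bar R) :
  measurable_fun setT g -> (forall z, 0 <= g z) ->
  \int[m]_x int_Rd (fun s => g (x, s)) = int_Rd (fun s => \int[m]_x g (x, s)).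
Proof.
move=> mg g0.
apply: (@iter_int_exchange _ d _ T m (fun z => g (z.1, (\row_j z.2 j)%R))) => //.
exact: (measurableT_comp mg (@measurable_pair_row _ _)).
Qed.

Lemma int_RdZl (k : R) (g : rowType R d -> \bar R) : (0 <= k)%R ->
  measurable_fun setT g -> (forall s, 0 <= g s) ->
  int_Rd (fun s => k%:E * g s) = k%:E * int_Rd g.
Proof.
move=> k0 mg g0.
apply: (@iter_intZl _ d k (fun v => g (\row_j v j)%R)) => //.
exact: (measurableT_comp mg (@measurable_row_of_fun R d)).
Qed.

Lemma ge0_int_RdN (g : rowType R d -> \bar R) :
  measurable_fun setT g -> (forall s, 0 <= g s) ->
  int_Rd (fun s => g (- s)%R) = int_Rd g.
Proof.
move=> mg g0.
rewrite /int_Rd -(@ge0_iter_intN _ d (fun v => g (\row_j v j)%R)) => //.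
  congr iter_int; apply/funext => v; congr g; apply/rowP => j.
  by rewrite !mxE.
exact: (measurableT_comp mg (@measurable_row_of_fun R d)).
Qed.

End int_Rd_theory.

(** * The radial density *)

Section radial_density.
Local Open Scope ereal_scope.
Context (R : realType).
Local Notation mu := (@lebesgue_measure R).

(** The image of Lebesgue measure under multiplication by [c], multiplied by [c], gives []a, b]] the
    mass [c * (b / c - a / c)], so it is Lebesgue measure by uniqueness. *)
Lemma ge0_integral_scale (c : R) (f : R -> \bar R) : (0 < c)%R ->
  measurable_fun setT f -> (forall x, 0 <= f x) ->
  c%:E * \int[mu]_x f (c * x)%R = \int[mu]_x f x.
Proof.
move=> c0 mf f0.
pose phi : measurableTypeR R -> measurableTypeR R := fun x => (c * x)%R.
have mphi : measurable_fun setT phi by exact: measurable_funM.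
pose nu_of : {measure set (measurableTypeR R) -> \bar R} :=
  mscale (NngNum (ltW c0)) (pushforward mu phi).
pose nu := nu_of mphi.
have nuE A : measurable A -> mu A = nu A.
  apply: lebesgue_measure_unique => //= _ [[a b]] _ <-.
  rewrite /nu /nu_of/= /mscale/= /pushforward.
  have -> : phi @^-1` `]a, b] = `](a / c)%R, (b / c)%R]%classic.
    by apply/seteqP; split => x /=;
      rewrite !in_itv/= ltr_pdivrMr// ler_pdivlMr// (mulrC x).
  rewrite !lebesgue_measure_itv/= !lte_fin ltr_pM2r ?invr_gt0//.
  case: ifP => _; rewrite ?mule0//.
  by rewrite -!EFinD -EFinM -mulrBl mulrCA divff ?mulr1// gt_eqF.
transitivity (\int[nu]_x f x); last first.
  by apply: eq_measure_integral => A mA _; exact/esym/nuE.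
by rewrite /nu /nu_of ge0_integral_mscale// ge0_integral_pushforward.
Qed.

(** The density is extended by 0 to the whole line, so that all radial integrals run over the full
    measure space required by Tonelli and by the scaling lemma. *)
Definition radial_density (u : R) : R := if (0 < u)%R then u ^- 2 else 0%R.

Lemma radial_density_ge0 u : (0 <= radial_density u)%R.
Proof. by rewrite /radial_density; case: ifP => // u0; rewrite invr_ge0 sqr_ge0. Qed.

Lemma measurable_radial_density : measurable_fun setT radial_density.
Proof.
have mpos : measurable [set u : R | (0 < u)%R].
  by rewrite (_ : mkset _ = `]0%R, +oo[%classic) // set_itvoy.
(* On the positive half-line [u ^- 2] is a real power, and power functions are measurable. *)
have -> : radial_density =
    (fun u => \1_[set u : R | (0 < u)%R] u * (u `^ (- 2%:R)))%R.
  apply/funext => u; rewrite /radial_density indicE; case: ifPn => u0.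
    by rewrite mem_set//= mul1r powRN powR_mulrn// ltW.
  by rewrite memNset ?mul0r//=; exact/negP.
apply: measurable_funM; first exact: measurable_indic.
exact: measurable_powR.
Qed.

Lemma integral_radial_density (g : R -> \bar R) :
  \int[mu]_(u in [set u : R | (0 < u)%R]) ((u ^- 2)%:E * g u) =
  \int[mu]_u ((radial_density u)%:E * g u).
Proof.
rewrite integral_mkcond; apply: eq_integral => u _.
rewrite patchE /radial_density; case: ifPn => [/set_mem/= ->//|].
by move/negP; rewrite in_setE/= => /negP/negbTE ->; rewrite mul0e.
Qed.

Lemma integral_radial_scale (c : R) (f : R -> \bar R) : (0 < c)%R ->
  measurable_fun setT f -> (forall x, 0 <= f x) ->
  \int[mu]_u ((radial_density u)%:E * f (c * u)%R) =
  \int[mu]_v ((radial_density v)%:E * (f v * c%:E)).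
Proof.
move=> c0 mf f0.
pose g v := (radial_density v)%:E * f v.
have mg : measurable_fun setT g.
  apply: emeasurable_funM => //; apply/measurable_EFinP.
  exact: measurable_radial_density.
have g0 v : 0 <= g v by rewrite mule_ge0// lee_fin radial_density_ge0.
(* The density is homogeneous of degree -2, whence [c ^+ 2]. One factor [c] is absorbed by the
   change of variable, the other remains as the weight. *)
transitivity (\int[mu]_u ((c ^+ 2)%:E * g (c * u)%R)).
  apply: eq_integral => u _; rewrite /g muleA -EFinM; congr (_%:E * _).
  rewrite /radial_density pmulr_rgt0//; case: ifP => u0; last by rewrite mulr0.
  by rewrite [in RHS]exprMn [in RHS]invfM mulVKf // sqrf_eq0 gt_eqF.
rewrite ge0_integralZl//; last 2 first.
- apply: measurableT_comp => //; exact: measurable_funM.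
- by rewrite lee_fin sqr_ge0.
rewrite expr2 EFinM -muleA ge0_integral_scale//.
rewrite -ge0_integralZl// ?lee_fin ?ltW//.
by apply: eq_integral => v _; rewrite /g muleC -muleA.
Qed.

End radial_density.

(** * The intensity of exceedances *)

Section exceedance.
Local Open Scope ereal_scope.
Context (R : realType).

(** The strict inequality makes the complement a product of closed lower rays, and makes exceedance
    an open condition on [y]. *)
Definition exceeds n (x y : 'I_n -> \bar R) : Prop := exists j, x j < y j.

Lemma measurable_exceeds n dT (T : measurableType dT) (x : 'I_n -> \bar R)
    (a : 'I_n -> T -> \bar R) :
  (forall j, measurable_fun setT (a j)) ->
  measurable [set z | exceeds x (a ^~ z)].
Proof.
move=> ma.
have -> : [set z | exceeds x (a ^~ z)] =
    \bigcup_(j in [set: 'I_n]) [set z | x j < a j z].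
  by apply/seteqP; split => [z [j xj]|z [j _ xj]]; exists j.
apply: fin_bigcup_measurable => // j _.
rewrite -[X in measurable X]setTI.
by apply: measurable_lte => //; exact: measurable_cst.
Qed.

Definition path_exceed d n (t : 'I_n -> 'rV[R]_d) (x : 'I_n -> \bar R) (u : R) :
    set ('rV[R]_d -> R) :=
  [set f | exceeds x (fun j => (u * f (t j))%:E)].

Lemma cyl_meas_path_exceed d n (t : 'I_n -> 'rV[R]_d) x u :
  cyl_meas (path_exceed t x u).
Proof.
apply: (@measurable_exceeds n _ (cylType 'rV[R]_d R) x
  (fun j f => (u * f (t j))%:E)) => j.
apply/measurable_EFinP; apply: measurable_funM => //.
exact: measurable_eval.
Qed.

(** [grid_eval] stands in for evaluation so that the set lies in [mark_meas]; on continuous marks,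
    the only ones that occur, the two agree. *)
Definition mark_exceed d n (t : 'I_n -> 'rV[R]_d) (x : 'I_n -> \bar R) :
    set (R * 'rV[R]_d * ('rV[R]_d -> R)) :=
  [set z | exceeds x (fun j => z.1.1%:E * grid_eval z.2 (t j - z.1.2)%R)].

Lemma mark_exceedE d n (t : 'I_n -> 'rV[R]_d) x u s f : continuous f ->
  mark_exceed t x (u, s, f) =
  exceeds x (fun j => (u * f (t j - s)%R)%:E).
Proof.
move=> cf; rewrite /mark_exceed/=; congr exceeds; apply/funext => j.
by rewrite grid_eval_continuous.
Qed.

Lemma mark_meas_mark_exceed d n (t : 'I_n -> 'rV[R]_d) x :
  mark_meas (mark_exceed t x).
Proof.
apply: mark_measP.
pose T := (R * rowType R d * cylType 'rV[R]_d R)%type.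
apply: (@measurable_exceeds n _ T x
  (fun j z => z.1.1%:E * grid_eval z.2 (t j - z.1.2)%R)) => j.
have m11 : measurable_fun setT (fun z : T => z.1.1).
  exact: (measurableT_comp measurable_fst measurable_fst).
have m12 : measurable_fun setT (fun z : T => z.1.2).
  exact: (measurableT_comp measurable_snd measurable_fst).
apply: emeasurable_funM; first exact/measurable_EFinP.
apply: measurable_grid_eval; first exact: measurable_snd.
exact: (measurableT_comp (@measurable_rowB R d (t j)) m12).
Qed.

End exceedance.

Lemma eq_indic (R : pzRingType) (T T' : Type) (A : set T) (B : set T') a b :
  A a = B b -> \1_A a = \1_B b :> R.
Proof.
move=> e; rewrite !indicE (_ : (a \in A) = (b \in B))//.
by apply/idP/idP => /set_mem h; apply/mem_set; [rewrite -e|rewrite e].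
Qed.

(** * Equality of the exponents of the two processes *)

Section intensity.
Local Open Scope ereal_scope.
Context (R : realType) (d : nat) (d0 : measure_display) (Om : measurableType d0)
  (P : probability Om R) (F : Om -> 'rV[R]_d -> R).
Hypotheses (F_meas : forall t, measurable_fun [set: Om] (fun w => F w t))
  (F_cont : forall w, continuous (F w)) (F_pos : forall w t, (0 < F w t)%R).
Local Notation mu := (@lebesgue_measure R).

Lemma measurable_random_field dT (T : measurableType dT) (g : T -> 'rV[R]_d)
    (h : T -> Om) :
  measurable_fun setT (g : T -> rowType R d) -> measurable_fun setT h ->
  measurable_fun setT (fun z => F (h z) (g z)).
Proof.
move=> mg mh.
apply: (@measurable_random_eval R d _ T (fun z => F (h z)) g) => //.
apply: measurable_cylP => t; exact: (measurableT_comp (F_meas t) mh).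
Qed.

(** Every path [F w (s - t) / F w (- t)] equals 1 at [s = 0], so the indicator disappears;
    reflecting [t] leaves the expected integral of [F]. *)
Lemma W_law_normalized :
  \int[P]_w int_Rd (fun t => (F w t)%:E) = 1 ->
  W_law P F [set f : 'rV[R]_d -> R | f (0 : 'rV[R]_d)%R = 1%R] = 1.
Proof.
move=> <-; apply: eq_integral => w _.
rewrite -(@ge0_int_RdN R d (fun s => (F w s)%:E)).
- congr int_Rd; apply/funext => s.
  rewrite indicE mem_set ?mul1e//=.
  by rewrite sub0r divff// gt_eqF.
- apply/measurable_EFinP.
  exact: (@measurable_random_field _ (rowType R d) id (cst w)).
- by move=> s; rewrite lee_fin ltW.
Qed.

Context (n : nat) (t : 'I_n -> 'rV[R]_d) (x : 'I_n -> \bar R).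

Let T := (R * rowType R d * Om)%type.
(** [G] is the integrand behind [mark_intensity], and [H] the one behind [W_law], with the
    normalized path and its weight. For fixed location and sample, the radial substitution carries
    [G] into [H]. *)
Let G (z : T) : \bar R :=
  (\1_[set z : T | exceeds x (fun j => (z.1.1 * F z.2 (t j - z.1.2)%R)%:E)] z)%:E.
Let H (z : T) : \bar R :=
  (\1_[set z : T | exceeds x
         (fun j => (z.1.1 * (F z.2 (t j - z.1.2)%R / F z.2 (- z.1.2)%R))%:E)] z)%:E
   * (F z.2 (- z.1.2)%R)%:E.

Let m11 : measurable_fun setT (fun z : T => z.1.1).
Proof. exact: (measurableT_comp measurable_fst measurable_fst). Qed.

Let m12 : measurable_fun setT (fun z : T => z.1.2).
Proof. exact: (measurableT_comp measurable_snd measurable_fst). Qed.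

Let mFB (s : 'rV[R]_d) : measurable_fun setT (fun z : T => F z.2 (s - z.1.2)%R).
Proof.
apply: measurable_random_field; last exact: measurable_snd.
exact: (measurableT_comp (@measurable_rowB R d s) m12).
Qed.

Let mFN : measurable_fun setT (fun z : T => F z.2 (- z.1.2)%R).
Proof.
apply: (eq_measurable_fun (fun z : T => F z.2 (0 - z.1.2)%R)) => //.
by move=> z _; rewrite sub0r.
Qed.

Let mG : measurable_fun setT G.
Proof.
apply/measurable_EFinP; apply: measurable_indic.
apply: (@measurable_exceeds R n _ T x
  (fun j z => (z.1.1 * F z.2 (t j - z.1.2)%R)%:E)) => j.
by apply/measurable_EFinP; apply: measurable_funM.
Qed.

Let G0 z : 0 <= G z.
Proof. by rewrite lee_fin. Qed.

Let mH : measurable_fun setT H.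
Proof.
apply: emeasurable_funM; last exact/measurable_EFinP.
apply/measurable_EFinP; apply: measurable_indic.
apply: (@measurable_exceeds R n _ T x
  (fun j z => (z.1.1 * (F z.2 (t j - z.1.2)%R / F z.2 (- z.1.2)%R))%:E)) => j.
apply/measurable_EFinP; apply: measurable_funM => //; apply: measurable_funM => //.
(* Positivity of [F] turns the reciprocal into a real power, which is measurable. *)
apply: (eq_measurable_fun (fun z : T => F z.2 (- z.1.2)%R `^ (-1))%R).
  by move=> z _; rewrite powRN powRr1// ltW.
exact: (measurableT_comp (@measurable_powR R (-1)) mFN).
Qed.

Let H0 z : 0 <= H z.
Proof. by rewrite mule_ge0// lee_fin// ltW. Qed.

Let k0 u : 0 <= (radial_density u)%:E :> \bar R.
Proof. by rewrite lee_fin radial_density_ge0. Qed.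

Let mk (K : T -> \bar R) : measurable_fun setT K ->
  measurable_fun setT (fun z : T => (radial_density z.1.1)%:E * K z).
Proof.
move=> mK; apply: emeasurable_funM => //; apply/measurable_EFinP.
exact: (measurableT_comp (@measurable_radial_density R) m11).
Qed.

Let mPK (K : T -> \bar R) : measurable_fun setT K -> (forall z, 0 <= K z) ->
  measurable_fun setT (fun z : R * rowType R d => \int[P]_w K (z, w)).
Proof. by move=> mK K0; exact: measurable_fun_fubini_tonelli_F. Qed.

(** Puts the radial integral innermost: the substitution has a factor depending on [s] and [w], so
    both must be fixed when it is made. *)
Let radial_exchange (K : T -> \bar R) : measurable_fun setT K ->
  (forall z, 0 <= K z) ->
  \int[mu]_u ((radial_density u)%:E * int_Rd (fun s => \int[P]_w K (u, s, w))) =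
  int_Rd (fun s => \int[P]_w \int[mu]_u ((radial_density u)%:E * K (u, s, w))).
Proof.
move=> mK K0.
pose K' (z : T) := (radial_density z.1.1)%:E * K z.
have mK' : measurable_fun setT K' by exact: mk.
have K'0 z : 0 <= K' z by exact: mule_ge0.
transitivity (\int[mu]_u int_Rd (fun s => \int[P]_w K' (u, s, w))).
  apply: eq_integral => u _; rewrite -int_RdZl ?radial_density_ge0//.
  - congr int_Rd; apply/funext => s; rewrite -ge0_integralZl//.
    exact: (measurableT_comp mK (pair1_measurable ((u, s) : R * rowType R d))).
  - exact: (measurableT_comp (mPK mK K0) (pair1_measurable u)).
  - by move=> s; exact: integral_ge0.
rewrite (@int_Rd_exchange _ _ _ _ mu (fun z => \int[P]_w K' (z, w))); last 2 first.
- exact: mPK.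
- by move=> z; exact: integral_ge0.
congr int_Rd; apply/funext => s.
apply: (@fubini_tonelli _ _ _ _ _ mu P (fun z => K' (z.1, s, z.2))) => //.
apply: (measurableT_comp mK'); apply: measurable_fun_pair; last exact: measurable_snd.
by apply: measurable_fun_pair => //; exact: measurable_fst.
Qed.

Lemma mark_intensity_exceed :
  mark_intensity P F (mark_exceed t x) =
  \int[mu]_v ((radial_density v)%:E * W_law P F (path_exceed t x v)).
Proof.
transitivity (\int[mu]_u ((radial_density u)%:E *
    int_Rd (fun s => \int[P]_w G (u, s, w)))).
  rewrite /mark_intensity integral_radial_density; apply: eq_integral => u _.
  congr (_ * int_Rd _); apply/funext => s; apply: eq_integral => w _.
  by rewrite /G; congr EFin; apply: eq_indic; rewrite mark_exceedE.
rewrite radial_exchange//.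
(* The right-hand side is brought to the same order of integration; [W_law] has its expectation
   outermost, which costs one more exchange. *)
transitivity (\int[mu]_v ((radial_density v)%:E *
    int_Rd (fun s => \int[P]_w H (v, s, w)))); last first.
  apply: eq_integral => v _; congr (_ * _).
  rewrite /W_law (@int_Rd_exchange _ _ _ _ P (fun z => H (v, z.2, z.1)))//.
  apply: (measurableT_comp mH); apply: measurable_fun_pair; last exact: measurable_fst.
  by apply: measurable_fun_pair => //; exact: measurable_snd.
rewrite radial_exchange//; congr int_Rd; apply/funext => s; apply: eq_integral => w _.
pose c := F w (- s)%R.
have c0 : (0 < c)%R by exact: F_pos.
pose f v : \bar R := (\1_[set v : R | exceeds x
         (fun j => (v * (F w (t j - s)%R / c))%:E)] v)%:E.
(* The radius enters only through [u * F w (t j - s) = (c * u) * (F w (t j - s) / c)]. *)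
transitivity (\int[mu]_u ((radial_density u)%:E * f (c * u)%R)).
  apply: eq_integral => u _; congr (_ * EFin _); apply: eq_indic => /=.
  congr exceeds; apply/funext => j; congr EFin.
  by rewrite (mulrC c) -mulrA [(c * _)%R]mulrCA divff ?mulr1// gt_eqF.
rewrite integral_radial_scale//.
- apply/measurable_EFinP; apply: measurable_indic.
  apply: (@measurable_exceeds R n _ R x
    (fun j v => (v * (F w (t j - s)%R / c))%:E)) => j.
  by apply/measurable_EFinP; exact: measurable_funM.
- by move=> v; rewrite lee_fin.
Qed.

End intensity.

(** * Counts of points *)

Section monotone_nat_sequence.
Context (R : realType) (a : nat -> nat).
Hypothesis nda : {homo a : m n / (m <= n)%N}.

(** Induction on the bound: if it is attained, monotonicity freezes the sequence from there on;
    otherwise a smaller bound holds. *)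
Lemma bounded_nat_seq_stationary m : (forall n, a n <= m)%N ->
  exists k, \forall n \near \oo, a n = k.
Proof.
elim: m => [|m IH] am.
  by exists 0%N; apply: nearW => n; apply/eqP; rewrite -leqn0.
have [[n0 an0]|nam] := pselect (exists n0, a n0 = m.+1).
  exists m.+1; near=> n; apply/eqP; rewrite eqn_leq am -an0 nda//.
  by near: n; exact: nbhs_infty_ge.
apply: IH => n; rewrite -ltnS ltn_neqAle am andbT.
by apply/eqP => anm; apply: nam; exists n.
Unshelve. all: by end_near. Qed.

Lemma nat_seq_limit (y : \bar R) : ((a n)%:R%:E @[n --> \oo] --> y)%E ->
  (exists k, y = k%:R%:E /\ \forall n \near \oo, a n = k) \/
  (y = +oo%E /\ (a n @[n --> \oo] --> \oo)).
Proof.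
move=> ay; have [[m am]|unb] := pselect (exists m, forall n, (a n <= m)%N).
  have [k ak] := bounded_nat_seq_stationary am; left; exists k; split => //.
  rewrite -(cvg_lim (@ereal_hausdorff R) ay); apply/cvg_lim => //.
  apply: cvg_near_cst.
  by apply: filterS ak => n ->.
have ainf : a n @[n --> \oo] --> \oo.
  apply/cvgnyPge => A.
  have [n0 An0] : exists n0, (A <= a n0)%N.
    apply: contrapT => H; apply: unb; exists A => n.
    by rewrite leqNgt; apply/negP => An; apply: H; exists n; exact: ltnW.
  near=> n; rewrite (leq_trans An0)// nda//.
  by near: n; exact: nbhs_infty_ge.
right; split => //; rewrite -(cvg_lim (@ereal_hausdorff R) ay).
apply/cvg_lim => //; apply/cvgeyPge => A.
move/cvgnyPge : ainf => /(_ (Num.truncn A).+1).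
apply: filterS => n An; rewrite lee_fin (le_trans (ltW (truncnS_gt A)))//.
by rewrite ler_nat.
Unshelve. all: by end_near. Qed.

End monotone_nat_sequence.

Section count_power.
Context (R : realType).

(** The power [c ^ N] for a count [N] in [\bar R]. Its value at [+oo] is the limit of [c ^+ k] for
    [c] in [0, 1]: it vanishes unless [c = 1]. *)
Definition count_power (c : R) (y : \bar R) : R :=
  if y is r%:E%E then c ^+ Num.truncn r else (c == 1)%:R.

Lemma count_power_ge0_le1 c y : 0 <= c <= 1 -> 0 <= count_power c y <= 1.
Proof.
move=> /andP[c0 c1]; case: y => [r||]/=; last 2 first.
- by case: (c == 1); rewrite ?lexx ler01.
- by case: (c == 1); rewrite ?lexx ler01.
by rewrite exprn_ge0//= exprn_ile1.
Qed.

Lemma count_power_nat c k : count_power c k%:R%:E = c ^+ k.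
Proof. by rewrite /= natrK. Qed.

Lemma count_power_cvg c (a : nat -> nat) (y : \bar R) : 0 <= c <= 1 ->
  {homo a : m n / (m <= n)%N} -> ((a n)%:R%:E @[n --> \oo] --> y)%E ->
  c ^+ a n @[n --> \oo] --> count_power c y.
Proof.
move=> /andP[c0 c1] nda /(nat_seq_limit nda)[[k [-> ak]]|[-> ainf]].
  rewrite count_power_nat; apply: cvg_near_cst.
  by apply: filterS ak => n ->.
rewrite /=; have [->|cn1] := eqVneq c 1.
  by under eq_fun do rewrite expr1n; exact: cvg_cst.
apply: (cvg_comp a (fun k => c ^+ k) ainf).
by apply: cvg_expr; rewrite ger0_norm// lt_neqAle cn1.
Qed.

End count_power.

Section pcount.
Local Open Scope ereal_scope.
Context (R : realType) (dT : measure_display) (T : measurableType dT) (E : Type)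
  (X : nat -> T -> E) (A : set E).

Definition partial_count n w : nat := (\sum_(i < n) (X i w \in A))%N.

Lemma partial_count_homo w : {homo partial_count ^~ w : m n / (m <= n)%N}.
Proof.
apply: homo_leq => //; first by move=> ? ? ?; exact: leq_trans.
by move=> n; rewrite /partial_count big_ord_recr leq_addr.
Qed.

Lemma partial_count_cvg w :
  (partial_count n w)%:R%:E @[n --> \oo] --> pcount R X A w.
Proof.
have -> : pcount R X A w = \sum_(i <oo | X i w \in A) 1.
  rewrite nneseries_esum//; congr esum.
  by apply/seteqP; split => i /=; [move/mem_set|move/set_mem].
rewrite (_ : (fun n => _) =
    (fun n => \sum_(0 <= i < n | X i w \in A) (1 : \bar R))); last first.
  apply/funext => n; rewrite /partial_count big_mkord [RHS]big_mkcond/=.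
  rewrite natr_sum -sumEFin; apply: eq_bigr => i _.
  by case: (X i w \in A).
by apply: is_cvg_nneseries_cond => n _.
Qed.

Lemma pcount_eq0 w : pcount R X A w = 0 <-> forall i, ~ A (X i w).
Proof.
split => [p0 i AXi|nA].
  suff : (1 : \bar R) <= 0 by rewrite leNgt lte01.
  rewrite -p0; apply: esum_ge; exists [set i].
    by split; [exact: finite_set1|move=> _ ->].
  by rewrite fsbig_set1.
rewrite /pcount (_ : [set i | _] = set0) ?esum_set0//.
by rewrite -subset0 => i /nA.
Qed.

(** Enumerates the possible counts with [+oo] in position 0, hence a shift by one: a count of zero
    is [count_value 1]. *)
Definition count_value (j : nat) : \bar R := if j is k.+1 then k%:R%:E else +oo.

Lemma count_value_inj : injective count_value.
Proof.
move=> [|i] [|j] //= [] /eqP; rewrite eqr_nat => /eqP -> //.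
Qed.

Lemma pcount_value w : exists j, pcount R X A w = count_value j.
Proof.
have [[k [-> _]]|[-> _]] := nat_seq_limit (@partial_count_homo w)
  (@partial_count_cvg w).
  by exists k.+1.
by exists 0%N.
Qed.

Hypothesis mXA : forall i, measurable (X i @^-1` A).

Lemma measurable_pcount : measurable_fun setT (pcount R X A).
Proof.
apply: (emeasurable_fun_cvg (fun n w => (partial_count n w)%:R%:E)).
  move=> n; apply/measurable_EFinP.
  rewrite (_ : (fun x => _) = (fun w => \sum_(i < n) \1_(X i @^-1` A) w)%R).
    by apply: measurable_sum => i; exact: measurable_indic.
  apply/funext => w; rewrite /partial_count natr_sum; apply: eq_bigr => i _.
  by rewrite indicE; congr (_%:R); congr nat_of_bool;
    apply/idP/idP => /set_mem H; apply/mem_set.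
by move=> w _; exact: partial_count_cvg.
Qed.

End pcount.

(** * Independence of countably valued variables *)

Section countable_valued.
Local Open Scope ereal_scope.
Context (R : realType) (dT : measure_display) (T : measurableType dT)
  (dS : measure_display) (S : measurableType dS) (e : nat -> S).
Hypotheses (e_inj : injective e) (me : forall j, measurable [set e j]).

Section expansion.
Variables (N : T -> S).
Hypotheses (mN : measurable_fun setT N) (Ne : forall w, exists j, N w = e j).

(** Exactly one term of the series is active, the one of the value taken. This is what yields
    measurability of [f (N w)] and its integral from the level sets of [N]. *)
Lemma countable_valued_expansion (f : S -> R) w : (forall s, 0 <= f s)%R ->
  (f (N w))%:E = \sum_(j <oo) (f (e j))%:E * (\1_[set e j] (N w))%:E.
Proof.
move=> f0; have [k Nk] := Ne w.
rewrite (@nneseriesD1 _ _ k)//; last first.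
  by move=> j _; rewrite -EFinM lee_fin mulr_ge0.
rewrite eseries0 ?adde0; last first.
  move=> j _ /andP[_ jk]; rewrite indicE memNset ?mule0//=.
  by rewrite Nk => /e_inj kj; rewrite kj eqxx in jk.
by rewrite Nk indicE mem_set// mule1.
Qed.

Lemma measurable_countable_valued (f : S -> R) : (forall s, 0 <= f s)%R ->
  measurable_fun setT (fun w => f (N w)).
Proof.
move=> f0; apply/measurable_EFinP.
rewrite (_ : EFin \o _ = fun w =>
    \sum_(j <oo) (f (e j))%:E * (\1_[set e j] (N w))%:E); last first.
  by apply/funext => w; exact: countable_valued_expansion.
apply: ge0_emeasurable_sum => j.
  by move=> w _ _; rewrite -EFinM lee_fin mulr_ge0.
move=> _; apply: measurable_funeM; apply/measurable_EFinP.
by apply: (measurableT_comp _ mN); exact: measurable_indic.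
Qed.

Lemma integral_countable_valued (P : {measure set T -> \bar R}) (f : S -> R) :
  (forall s, 0 <= f s)%R ->
  \int[P]_w (f (N w))%:E =
  \sum_(j <oo) (f (e j))%:E * P [set w | N w = e j].
Proof.
move=> f0.
have mNe j : measurable [set w | N w = e j].
  by rewrite -[X in measurable X]setTI; exact: (mN measurableT (me j)).
have mI j : measurable_fun setT (fun w => (\1_[set w | N w = e j] w)%:E : \bar R).
  by apply/measurable_EFinP; exact: measurable_indic.
transitivity (\int[P]_w \sum_(j <oo)
    (f (e j))%:E * (\1_[set w | N w = e j] w)%:E).
  apply: eq_integral => w _; rewrite (@countable_valued_expansion f)//.
rewrite integral_nneseries//; last 2 first.
- by move=> j; exact: measurable_funeM.
- by move=> j w _; rewrite -EFinM lee_fin mulr_ge0.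
apply: eq_eseriesr => j _; rewrite ge0_integralZl_EFin//.
by rewrite integral_indic ?setIT.
Qed.

End expansion.

Context (P : probability T R) (K : nat) (N : 'I_K -> T -> S).
Hypotheses (mN : forall k, measurable_fun setT (N k))
  (Ne : forall k w, exists j, N k w = e j)
  (indep : forall B : 'I_K -> set S, (forall k, measurable (B k)) ->
    P (\bigcap_(k in [set: 'I_K]) [set w | B k (N k w)]) =
    \prod_(k < K) P [set w | B k (N k w)]).

Let measurable_preim k (B : set S) : measurable B ->
  measurable [set w | B (N k w)].
Proof. by move=> mB; rewrite -[X in measurable X]setTI; exact: mN. Qed.

Let integral_indicN k (B : set S) : measurable B ->
  \int[P]_w (\1_B (N k w))%:E = P [set w | B (N k w)].
Proof.
move=> mB; transitivity (\int[P]_w (\1_[set w | B (N k w)] w)%:E).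
  by apply: eq_integral => w _; congr EFin; exact: eq_indic.
by rewrite integral_indic ?setIT//; exact: measurable_preim.
Qed.

Lemma integral_prod_indep (f : 'I_K -> S -> R) :
  (forall k s, 0 <= f k s <= 1)%R ->
  \int[P]_w (\prod_(k < K) f k (N k w))%:E =
  \prod_(k < K) \int[P]_w (f k (N k w))%:E.
Proof.
(* Coordinates are freed one at a time: if the identity holds when the [m]-th
   factor is any indicator of a value, summing over values gives it for any
   [f m]. *)
suff H m : forall f : 'I_K -> S -> R, (forall k s, 0 <= f k s <= 1)%R ->
    (forall k : 'I_K, (m <= k)%N -> exists2 B, measurable B & f k = \1_B) ->
    \int[P]_w (\prod_(k < K) f k (N k w))%:E =
    \prod_(k < K) \int[P]_w (f k (N k w))%:E.
  by move=> f01; apply: (H K) => // k; rewrite leqNgt ltn_ord.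
elim: m => [|m IH] {}f f01 fB.
  (* When all factors are indicators, the product is the indicator of an intersection and the claim
     is [indep] itself. *)
  have /choice[B fBE] : forall k, exists B, measurable B /\ f k = \1_B.
    by move=> k; have [B] := fB k (leq0n k); exists B.
  transitivity (\int[P]_w (\1_(\bigcap_(k in [set: 'I_K])
      [set w | B k (N k w)]) w)%:E).
    apply: eq_integral => w _; congr EFin.
    have [wB|wB] := pselect (forall k, B k (N k w)).
      rewrite indicE mem_set; last by move=> k _; exact: wB.
      by rewrite big1// => k _; rewrite (fBE k).2 indicE mem_set.
    rewrite indicE memNset; last by move=> h; apply: wB => k; exact: h.
    have [k Bk] : exists k, ~ B k (N k w) by exact/existsNP.
    by rewrite (bigD1 k)//= (fBE k).2 indicE memNset// mul0r.
  rewrite integral_indic// ?setIT; last first.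
    by apply: fin_bigcap_measurable => // k _; apply: measurable_preim; case: (fBE k).
  transitivity (\prod_(k < K) P [set w | B k (N k w)]).
    by apply: indep => k; case: (fBE k).
  apply: eq_bigr => k _; have [mB ->] := fBE k.
  by rewrite integral_indicN.
have [mK|Km] := ltnP m K; last first.
  by apply: IH => // k mk; have := leq_trans Km mk; rewrite leqNgt ltn_ord.
pose k0 := Ordinal mK.
(* [g j] falls under the induction hypothesis: its factor at [k0] is the indicator of one value, and
   the later factors are indicators already. *)
pose g j k := if k == k0 then \1_[set e j] else f k.
have g01 j k s : (0 <= g j k s <= 1)%R.
  rewrite /g; case: ifP => // _.
  by rewrite indicE; case: (_ \in _); rewrite ?lexx ?ler01.
have f0 k s : (0 <= f k s)%R by have /andP[] := f01 k s.
have g0 j k s : (0 <= g j k s)%R by have /andP[] := g01 j k s.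
have gI j : \int[P]_w (\prod_(k < K) g j k (N k w))%:E =
    \prod_(k < K) \int[P]_w (g j k (N k w))%:E.
  apply: IH => // k mk; rewrite /g; case: eqVneq => [_|kk0].
    by exists [set e j].
  by apply: fB; rewrite ltn_neqAle mk andbT; apply: contra kk0 => /eqP mk'; apply/eqP/val_inj.
pose rest := \prod_(k < K | k != k0) \int[P]_w (f k (N k w))%:E.
(* A finite constant is what may be moved inside the series over the values. *)
have [r restr] : exists r, rest = r%:E.
  suff : rest \is a fin_num by move=> /fineK <-; exists (fine rest).
  rewrite /rest; elim/big_ind: _ => //; first exact: fin_numM.
  move=> k _; rewrite ge0_fin_numE; last first.
    by apply: integral_ge0 => w _; rewrite lee_fin.
  apply: (@le_lt_trans _ _ (\int[P]_w (cst 1 w))); last first.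
    rewrite integral_cst// mul1e.
    by apply: le_lt_trans (probability_le1 P measurableT) _; exact: ltry.
  apply: ge0_le_integral => //.
  - by move=> w _; rewrite lee_fin.
  - by apply/measurable_EFinP; exact: measurable_countable_valued.
  - by move=> w _; rewrite lee_fin; have /andP[] := f01 k (N k w).
transitivity (\int[P]_w \sum_(j <oo)
    (f k0 (e j))%:E * (\prod_(k < K) g j k (N k w))%:E).
  apply: eq_integral => w _.
  rewrite (bigD1 k0)//= EFinM muleC (@countable_valued_expansion (N k0))//.
  rewrite -nneseriesZl; last by move=> j _; rewrite -EFinM lee_fin mulr_ge0.
  apply: eq_eseriesr => j _; rewrite muleCA; congr (_ * _).
  rewrite -EFinM (bigD1 k0 (F := fun k => g j k (N k w)))//= /g eqxx mulrC.
  by congr (_ * _)%:E; apply: eq_bigr => k /negbTE ->.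
rewrite integral_nneseries//; last 2 first.
- move=> j; apply: measurable_funeM; apply/measurable_EFinP.
  by apply: measurable_prod => k _; exact: measurable_countable_valued.
- by move=> j w _; rewrite -EFinM lee_fin mulr_ge0// prodr_ge0.
rewrite [RHS](bigD1 k0)//= -/rest restr muleC.
rewrite (eq_integral _ _ (fun w _ => @countable_valued_expansion (N k0) (Ne k0) (f k0) w (f0 k0))).
rewrite integral_nneseries//; last 2 first.
- move=> j; apply: measurable_funeM; apply/measurable_EFinP.
  by apply: (measurableT_comp _ (mN k0)); exact: measurable_indic.
- by move=> j w _; rewrite -EFinM lee_fin mulr_ge0.
rewrite -nneseriesZl; last first.
  by move=> j _; apply: integral_ge0 => w _; rewrite -EFinM lee_fin mulr_ge0.
apply: eq_eseriesr => j _.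
have Z (h : T -> R) : measurable_fun setT h -> (forall w, 0 <= h w)%R ->
    \int[P]_w ((f k0 (e j))%:E * (h w)%:E) = (f k0 (e j))%:E * \int[P]_w (h w)%:E.
  move=> mh h0; apply: ge0_integralZl_EFin => //; last exact/measurable_EFinP.
  by move=> w _; rewrite lee_fin.
rewrite (Z (fun w => \prod_(k < K) g j k (N k w))%R); last 2 first.
- by apply: measurable_prod => k _; exact: measurable_countable_valued.
- by move=> w; exact: prodr_ge0.
rewrite (Z (fun w => \1_[set e j] (N k0 w))); last 2 first.
- by apply: (measurableT_comp _ (mN k0)); exact: measurable_indic.
- by [].
rewrite gI muleCA; congr (_ * _).
rewrite (bigD1 k0)//= muleC -restr /rest /g eqxx; congr (_ * _).
by apply: eq_bigr => k /negbTE ->.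
Qed.

End countable_valued.

(** * Void probabilities and generating functions *)

Section poisson_counts.
Local Open Scope ereal_scope.
Context (R : realType) (dT : measure_display) (T : measurableType dT)
  (P : probability T R) (E : Type) (SE : set (set E)) (Lam : set E -> \bar R)
  (X : nat -> T -> E).
Hypotheses (PPP : is_PPP P SE Lam X) (Lam_ge0 : forall A, SE A -> 0 <= Lam A).

Lemma exp_nneseries (x : R) : (0 <= x)%R ->
  \sum_(k <oo) (x ^+ k / k`!%:R)%:E = (expR x)%:E.
Proof.
move=> x0; rewrite expRE -EFin_lim; last first.
  rewrite /pseries/=; under eq_fun do rewrite mulrC.
  exact: is_cvg_series_exp_coeff.
apply/congr_lim/funext => n/=; rewrite /pseries/= /series/= -sumEFin//.
by under [RHS]eq_bigr do rewrite mulrC.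
Qed.

Section one_set.
Variable A : set E.
Hypothesis SEA : SE A.
Let N := pcount R X A.

Lemma PPP_measurable_pcount : measurable_fun setT N.
Proof. by case: PPP => mX _ _ _; apply: measurable_pcount => i; exact: mX. Qed.

Let mN j : measurable [set w | N w = count_value R j].
Proof.
rewrite -[X in measurable X]setTI.
exact: (PPP_measurable_pcount measurableT (emeasurable_set1 (count_value R j))).
Qed.

Let integral_count (f : \bar R -> R) : (forall y, 0 <= f y)%R ->
  \int[P]_w (f (N w))%:E =
  \sum_(j <oo) (f (count_value R j))%:E * P [set w | N w = count_value R j].
Proof.
move=> f0; apply: (@integral_countable_valued R _ T _ (\bar R) (count_value R)
  (@count_value_inj R) _ N) => //.
- exact: PPP_measurable_pcount.
- exact: pcount_value.
Qed.

Let integral_count_split (f : \bar R -> R) : (forall y, 0 <= f y)%R ->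
  \int[P]_w (f (N w))%:E = (f +oo%E)%:E * P [set w | N w = +oo] +
  \sum_(k <oo) (f k%:R%:E%E)%:E * P [set w | N w = k%:R%:E].
Proof.
move=> f0; rewrite integral_count// nneseries_recl//; last first.
  by move=> j _; apply: mule_ge0 => //; rewrite lee_fin.
congr (_ + _).
rewrite -(@nneseries_addn _ (fun j =>
  (f (count_value R j))%:E * P [set w | N w = count_value R j]) 1%N).
  by apply: eq_eseriesr => k _; rewrite addn1.
by move=> j; rewrite mule_ge0// lee_fin.
Qed.

(** For finite intensity this is the exponential series of [c * l]. For infinite intensity the count
    is almost surely infinite, and the value of [count_power] at [+oo] matches the right-hand side,
    where [0 * +oo = 0] covers [c = 1]. *)
Lemma PPP_generating_function (c : R) : (0 <= c <= 1)%R ->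
  \int[P]_w (count_power c (N w))%:E = expeR (- ((1 - c)%:E * Lam A)).
Proof.
move=> c01; have /andP[c0 c1] := c01.
have cp0 y : (0 <= count_power c y)%R by have /andP[] := count_power_ge0_le1 y c01.
case: PPP => _ fin inf _.
have [Loo|Lfin] := eqVneq (Lam A) +oo.
  have Poo : P [set w | N w = +oo] = 1 by exact: inf.
  (* The event is disjoint from one of probability 1. *)
  have Pk k : P [set w | N w = k%:R%:E] = 0.
    apply/eqP; rewrite eq_le measure_ge0 andbT.
    have H : P [set w | N w = +oo] + P [set w | N w = k%:R%:E] <= 1.
      rewrite -measureU; [|exact: (mN 0)|exact: (mN k.+1)|].
        by apply: probability_le1; apply: measurableU; [exact: (mN 0)|exact: (mN k.+1)].
      by rewrite -subset0 => w /= [->].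
    by move: H; rewrite Poo -[X in _ <= X]adde0 leeD2lE.
  rewrite integral_count_split// Poo eseries0; last by move=> k _ _; rewrite Pk mule0.
  rewrite adde0 mule1 Loo /=; have [->|cn1] := eqVneq c 1%R.
    by rewrite subrr mul0e oppe0 expeR0.
  rewrite gt0_muley ?lte_fin ?subr_gt0 ?lt_neqAle ?cn1//.
have [l l0 LE] : exists2 l, (0 <= l)%R & Lam A = l%:E.
  have := Lam_ge0 SEA; case: (Lam A) Lfin => [l||]// _ l0.
  by exists l.
have Pk k : P [set w | N w = k%:R%:E] = (expR (- l))%:E * (l ^+ k / k`!%:R)%:E.
  by rewrite fin ?LE ?ltry//= /poisson_mass -EFinM mulrC.
(* The Poisson masses already sum to 1, as integrating the constant 1 shows, so nothing is left for
   an infinite count. *)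
have Poo : P [set w | N w = +oo] = 0.
  have := @integral_count_split (fun=> 1%R) (fun=> ler01).
  have -> : \int[P]_w (1%R)%:E = 1.
    by rewrite integral_cst// mul1e; exact: probability_setT.
  rewrite mul1e.
  under eq_eseriesr do rewrite mul1e Pk.
  rewrite nneseriesZl; last by move=> k _; rewrite lee_fin divr_ge0 ?exprn_ge0.
  rewrite exp_nneseries// -EFinM expRN mulVf ?gt_eqF ?expR_gt0//.
  move=> e1; apply/eqP; rewrite eq_le measure_ge0 andbT.
  by rewrite -(@leeD2lE _ 1)// adde0 addeC -e1.
rewrite integral_count_split// Poo mule0 add0e LE.
transitivity (\sum_(k <oo) (expR (- l))%:E * (((c * l) ^+ k / k`!%:R)%:E)).
  apply: eq_eseriesr => k _; rewrite count_power_nat Pk -!EFinM.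
  by rewrite exprMn mulrCA !mulrA.
rewrite nneseriesZl; last first.
  by move=> k _; rewrite lee_fin divr_ge0 ?exprn_ge0 ?mulr_ge0.
rewrite exp_nneseries ?mulr_ge0// -EFinM -expRD /=; congr (expR _)%:E.
by rewrite mulrBl mul1r opprB addrC.
Qed.

(** The case [c = 0] of the generating function: [0 ^ N] is the indicator of [N = 0], an infinite
    count also giving 0. *)
Lemma PPP_void : P [set w | forall i, ~ A (X i w)] = expeR (- Lam A).
Proof.
rewrite (_ : - Lam A = - ((1 - 0)%:E * Lam A)); last by rewrite subr0 mul1e.
rewrite -PPP_generating_function ?lexx ?ler01//.
have -> : [set w | forall i, ~ A (X i w)] = [set w | N w = count_value R 1].
  by apply/seteqP; split => w /= H; apply/(@pcount_eq0 R _ T E X A w).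
transitivity (\int[P]_w (\1_[set w | N w = count_value R 1] w)%:E).
  by rewrite integral_indic ?setIT//; exact: (mN 1).
apply: eq_integral => w _; congr EFin; rewrite indicE.
have [[|k] Nk] : exists j, N w = count_value R j by exact: pcount_value.
  by rewrite Nk/= memNset/=; [rewrite eq_sym oner_eq0|rewrite Nk].
rewrite Nk count_power_nat.
case: k Nk => [|k] Nk; first by rewrite mem_set.
rewrite memNset ?expr0n//= Nk => -[] /eqP; by rewrite eqr_nat.
Qed.

End one_set.

Context (K : nat) (kappa : E -> 'I_K) (c : 'I_K -> R).
Hypotheses (skappa : forall k, SE [set x | kappa x = k])
  (c01 : forall k, (0 <= c k <= 1)%R).

Lemma prod_partition_count n w :
  (\prod_(i < n) c (kappa (X i w)) =
   \prod_(k < K) c k ^+ partial_count X [set x | kappa x = k] n w)%R.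
Proof.
rewrite /partial_count.
under [RHS]eq_bigr do rewrite -prodrXr.
rewrite exchange_big/=; apply: eq_bigr => i _.
rewrite (bigD1 (kappa (X i w)))//= mem_set//= expr1 big1 ?mulr1//.
by move=> k kX; rewrite memNset//= => kE; rewrite kE eqxx in kX.
Qed.

(** Grouped by class, the product over the first [n] points consists of powers with the partial
    counts as exponents. These converge pointwise and stay in [0, 1], and the mean of the limit
    factors because counts of disjoint classes are independent. *)
Lemma PPP_prod_cvg :
  \int[P]_w (\prod_(i < n) c (kappa (X i w)))%:E @[n --> \oo] -->
  \prod_(k < K) expeR (- ((1 - c k)%:E * Lam [set x | kappa x = k])).
Proof.
pose N k := pcount R X [set x | kappa x = k].
have mN k : measurable_fun setT (N k) by exact: PPP_measurable_pcount.
have -> : \prod_(k < K) expeR (- ((1 - c k)%:E * Lam [set x | kappa x = k])) =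
    \int[P]_w (\prod_(k < K) count_power (c k) (N k w))%:E.
  rewrite (@integral_prod_indep R _ T _ _ (count_value R) _ _ P K N _ _ _
    (fun k => count_power (c k))).
  - by apply: eq_bigr => k _; rewrite PPP_generating_function.
  - exact: count_value_inj.
  - by move=> j; exact: emeasurable_set1.
  - exact: mN.
  - by move=> k w; exact: pcount_value.
  - move=> B mB; case: PPP => _ _ _ ind.
    apply: (ind K (fun k => [set x | kappa x = k]) B skappa _ mB).
    by move=> j k jk; rewrite -subset0 => x /= [xj xk]; rewrite -xj -xk eqxx in jk.
  - by move=> k y; exact: count_power_ge0_le1.
have cprod n w : (0 <= \prod_(i < n) c (kappa (X i w)) <= 1)%R.
  apply/andP; split; last by apply: prodr_ile1 => i _; exact: c01.
  by apply: prodr_ge0 => i _; have /andP[] := c01 (kappa (X i w)).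
apply: (@dominated_cvg _ _ _ P setT measurableT _ _ (cst 1)) => //.
- move=> n; apply/measurable_EFinP.
  apply: measurable_prod => i _.
  apply: (eq_measurable_fun (fun w =>
      \sum_(k < K) c k * \1_(X i @^-1` [set x | kappa x = k]) w)%R).
    move=> w _; rewrite (bigD1 (kappa (X i w)))//= indicE mem_set// mulr1.
    rewrite big1 ?addr0// => k kX; rewrite indicE memNset ?mulr0//= => kE.
    by rewrite kE eqxx in kX.
  apply: measurable_sum => k; apply: measurable_funM => //.
  by apply: measurable_indic; case: PPP => mX _ _ _; exact: mX.
- move=> w _; apply: cvg_EFin; first exact: nearW.
  under eq_fun do rewrite prod_partition_count.
  apply: (@cvg_big R^o _ _ _ xpredT (@mul_continuous R)) => k _; apply: count_power_cvg => //.
    exact: partial_count_homo.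
  exact: partial_count_cvg.
- exact: finite_measure_integrable_cst.
- move=> n w _; have /andP[p0 p1] := cprod n w.
  by rewrite lee_fin ger0_norm.
Qed.

End poisson_counts.

(** * Marked Poisson processes with finitely many mark laws *)

Lemma prod_expeRN (R : realType) (K : nat) (a : 'I_K -> \bar R) :
  (forall k, 0 <= a k)%E ->
  (\prod_(k < K) expeR (- a k) = expeR (- \sum_(k < K) a k))%E.
Proof.
move=> a0; suff : (0 <= \sum_(k < K) a k)%E /\
    (\prod_(k < K) expeR (- a k) = expeR (- \sum_(k < K) a k))%E by case.
elim/big_ind2 : _ => //; first by rewrite oppe0 expeR0.
move=> _ x _ y [x0 ->] [y0 ->]; split; first exact: adde_ge0.
by rewrite -expeRD oppeD// ge0_adde_def// inE.
Qed.

(** [kappa] gives the position of the value in a list without duplicates, so each class is a level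
    set of [h]. *)
Lemma finite_range_index (R : realType) dT (T : measurableType dT) (h : T -> R) :
  measurable_fun setT h -> finite_set (range h) ->
  exists (K : nat) (kappa : T -> 'I_K) (v : 'I_K -> R),
    (forall k, measurable [set u | kappa u = k]) /\ forall u, v (kappa u) = h u.
Proof.
move=> mh /finite_seqP[s0 hs0]; pose s := undup s0.
have hs u : h u \in s.
  by rewrite mem_undup; suff : [set` s0] (h u) by []; rewrite -hs0; exists u.
have ilt u : (index (h u) s < size s)%N by rewrite index_mem.
exists (size s), (fun u => Ordinal (ilt u)), (fun k => nth 0 s k).
split => [k|u]; last by rewrite nth_index.
rewrite (_ : [set u | _] = h @^-1` [set nth 0 s k]).
  by rewrite -[X in measurable X]setTI; exact: mh.
apply/seteqP; split => u /=; first by move=> <-; rewrite nth_index.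
by move=> hu; apply/val_inj => /=; rewrite hu index_uniq// undup_uniq.
Qed.

Section marked_poisson.
Local Open Scope ereal_scope.
Context (R : realType) (dT : measure_display) (T : measurableType dT)
  (P : probability T R) (S : Type) (dV : measure_display) (V : measurableType dV)
  (U : nat -> T -> R) (W : nat -> T -> (S -> V)) (Q : set (S -> V) -> \bar R).
Hypotheses (U_PPP : is_PPP P (@measurable _ R) (@radial_intensity R) U)
  (W_meas : forall i L, cyl_meas L -> measurable (W i @^-1` L))
  (W_distr : forall i L, cyl_meas L -> P (W i @^-1` L) = Q L)
  (UW_indep : forall (n : nat) (L : 'I_n -> set (S -> V)) (A : set (nat -> R)),
     (forall j, cyl_meas (L j)) -> cyl_meas A ->
     P ([set w | A (fun i => U i w)] `&`
        \bigcap_(j in [set: 'I_n]) [set w | L j (W j w)]) =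
     P [set w | A (fun i => U i w)] * \prod_(j < n) P [set w | L j (W j w)]).

Lemma cyl_measC (L : set (S -> V)) : cyl_meas L -> cyl_meas (~` L).
Proof. exact: sigma_algebraC. Qed.

Lemma radial_intensity_ge0 (A : set R) : measurable A -> 0 <= radial_intensity A.
Proof.
move=> mA; apply: integral_ge0 => u _; rewrite -EFinM lee_fin mulr_ge0//.
by rewrite invr_ge0 sqr_ge0.
Qed.

Section finite_types.
Context (K : nat) (kappa : R -> 'I_K) (L : 'I_K -> set (S -> V)).
Hypotheses (mkappa : forall k, measurable [set u | kappa u = k])
  (mL : forall k, cyl_meas (L k)).
Let c k : R := fine (Q (L k)).

Let QE k : Q (L k) = (c k)%:E.
Proof.
rewrite /c fineK// -(W_distr 0)//.
by apply: fin_num_measure; exact: W_meas.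
Qed.

Let c01 k : (0 <= c k <= 1)%R.
Proof.
rewrite -!lee_fin -QE -(W_distr 0)//; apply/andP; split; first exact: measure_ge0.
by apply: probability_le1; exact: W_meas.
Qed.

(** The constraint on a mark depends on its radius, whereas independence speaks of fixed sets.
    Splitting over the finitely many class patterns of the first [n] radii makes the constraint on
    each mark fixed. *)
Let pattern n (s : {ffun 'I_n -> 'I_K}) : set (nat -> R) :=
  [set u | forall i : 'I_n, kappa (u i) = s i].

Let cyl_pattern n (s : {ffun 'I_n -> 'I_K}) : cyl_meas (pattern s).
Proof.
have -> : pattern s = \bigcap_(i in [set: 'I_n]) [set u | kappa (u i) = s i].
  by apply/seteqP; split => u us i => [_|]; exact: us.
apply: (@fin_bigcap_measurable _ (cylType nat R)) => // i _.
rewrite -[X in measurable X]setTI.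
exact: (@measurable_eval nat _ R (i : nat) measurableT _ (mkappa (s i))).
Qed.

Let U_pattern n (s : {ffun 'I_n -> 'I_K}) := [set w | pattern s (fun i => U i w)].

Let measurable_U_pattern n (s : {ffun 'I_n -> 'I_K}) : measurable (U_pattern s).
Proof.
rewrite (_ : U_pattern s =
    \bigcap_(i in [set: 'I_n]) (U i @^-1` [set u | kappa u = s i])).
  apply: fin_bigcap_measurable => // i _.
  by case: U_PPP => mU _ _ _; exact: mU.
by apply/seteqP; split => w H i => [_|]; exact: H.
Qed.

Let pattern_sum n (g : {ffun 'I_n -> 'I_K} -> R) w :
  (g [ffun i : 'I_n => kappa (U i w)] =
   \sum_(s : {ffun 'I_n -> 'I_K}) \1_(U_pattern s) w * g s)%R.
Proof.
rewrite (bigD1 [ffun i : 'I_n => kappa (U i w)])//= indicE mem_set; last first.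
  by move=> i; rewrite ffunE.
rewrite mul1r big1 ?addr0// => s sU; rewrite indicE memNset ?mul0r// => sw.
by move/eqP : sU; apply; apply/ffunP => i; rewrite ffunE sw.
Qed.

Let marked n := [set w | forall i, (i < n)%N -> L (kappa (U i w)) (W i w)].

Let marked_bigcap n : marked n =
  \bigcap_(i in [set: 'I_n]) [set w | L (kappa (U i w)) (W i w)].
Proof.
apply/seteqP; split => w H i; first by move=> _; exact: H.
by move=> im; exact: (H (Ordinal im)).
Qed.

Let measurable_marked1 i : measurable [set w | L (kappa (U i w)) (W i w)].
Proof.
rewrite (_ : mkset _ = \bigcup_(k in [set: 'I_K])
    ((U i @^-1` [set u | kappa u = k]) `&` (W i @^-1` L k))).
  apply: fin_bigcup_measurable => // k _; apply: measurableI.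
    by case: U_PPP => mU _ _ _; exact: mU.
  exact: W_meas.
apply/seteqP; split => [w Lw|w [k _ [/= <-]]]//.
by exists (kappa (U i w)).
Qed.

Lemma measurable_marked_void_finite :
  measurable [set w | forall i, L (kappa (U i w)) (W i w)].
Proof.
rewrite (_ : mkset _ = \bigcap_i [set w | L (kappa (U i w)) (W i w)]).
  exact: bigcapT_measurable.
by apply/seteqP; split => w H i => [_|]; exact: H.
Qed.

Let measurable_marked n : measurable (marked n).
Proof. by rewrite marked_bigcap; apply: fin_bigcap_measurable. Qed.

Let marked_prob n :
  P (marked n) = \int[P]_w (\prod_(i < n) c (kappa (U i w)))%:E.
Proof.
pose B (s : {ffun 'I_n -> 'I_K}) :=
  \bigcap_(i in [set: 'I_n]) [set w | L (s i) (W i w)].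
have mB s : measurable (B s).
  by apply: fin_bigcap_measurable => // i _; exact: W_meas.
transitivity (\sum_(s : {ffun 'I_n -> 'I_K})
    P (U_pattern s) * (\prod_(i < n) c (s i))%:E).
  transitivity (\int[P]_w \sum_(s : {ffun 'I_n -> 'I_K})
      (\1_(U_pattern s `&` B s) w)%:E).
    transitivity (\int[P]_w (\1_(marked n) w)%:E).
      by rewrite integral_indic ?setIT.
    apply: eq_integral => w _; rewrite sumEFin; congr EFin.
    rewrite (_ : \1_(marked n) w = \1_(B [ffun i : 'I_n => kappa (U i w)]) w); last first.
      apply: eq_indic; rewrite marked_bigcap; apply/propext; split => H i _.
        by have := H i I; rewrite /= ffunE.
      by have := H i I; rewrite /= ffunE.
    rewrite (pattern_sum (fun s => \1_(B s) w)).
    by apply: eq_bigr => s _; rewrite indicI.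
  rewrite ge0_integral_sum//; last first.
    move=> s; apply/measurable_EFinP; apply: measurable_indic.
    exact: measurableI.
  apply: eq_bigr => s _; rewrite integral_indic ?setIT; last 2 first.
  - by [].
  - exact: measurableI.
  transitivity (P (U_pattern s) * \prod_(i < n) P [set w | L (s i) (W i w)]).
    exact: (UW_indep (fun j => mL (s j)) (@cyl_pattern n s)).
  congr (_ * _); rewrite -prodEFin; apply: eq_bigr => i _.
  by rewrite -QE -(W_distr i).
transitivity (\int[P]_w \sum_(s : {ffun 'I_n -> 'I_K})
    (\prod_(i < n) c (s i))%:E * (\1_(U_pattern s) w)%:E); last first.
  apply: eq_integral => w _.
  transitivity ((\prod_(i < n) c ([ffun i : 'I_n => kappa (U i w)] i))%:E : \bar R).
    rewrite (pattern_sum (fun s => \prod_(i < n) c (s i))%R) -sumEFin.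
    by apply: eq_bigr => s _; rewrite EFinM muleC.
  by congr EFin; apply: eq_bigr => i _; rewrite ffunE.
rewrite ge0_integral_sum//; last 2 first.
- move=> s; apply: measurable_funeM; apply/measurable_EFinP.
  exact: measurable_indic.
- move=> s w _; rewrite -EFinM lee_fin mulr_ge0// prodr_ge0// => i _.
  by have /andP[] := c01 (s i).
apply: eq_bigr => s _; rewrite ge0_integralZl_EFin//.
- by rewrite integral_indic ?setIT// muleC.
- by apply/measurable_EFinP; exact: measurable_indic.
- by apply: prodr_ge0 => i _; have /andP[] := c01 (s i).
Qed.

(** Both sides of [marked_prob] pass to the limit in [n]: the left by decreasing events, the right
    by [PPP_prod_cvg]. The resulting sum of [1 - c k] times class intensities is the radial integral
    split over the classes. *)
Lemma marked_void_finite :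
  P [set w | forall i, L (kappa (U i w)) (W i w)] =
  expeR (- \int[lebesgue_measure]_u
             ((radial_density u)%:E * Q (~` L (kappa u)))).
Proof.
have PL : P (marked n) @[n --> \oo] -->
    P [set w | forall i, L (kappa (U i w)) (W i w)].
  rewrite (_ : mkset _ = \bigcap_n marked n); last first.
    apply/seteqP; split => w H; first by move=> n _ i _; exact: H.
    by move=> i; exact: (H i.+1 I i (ltnSn i)).
  apply: nonincreasing_cvg_mu => //.
  - by apply: le_lt_trans (probability_le1 P (measurable_marked 0)) _; exact: ltry.
  - exact: bigcapT_measurable.
  - by move=> m n mn; apply/subsetPset => w H i im; apply: H; exact: leq_trans im mn.
have := PPP_prod_cvg U_PPP radial_intensity_ge0 mkappa c01.
rewrite -(funext marked_prob) => /(cvg_unique _ PL) ->//.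
have ri0 k : 0 <= radial_intensity [set u | kappa u = k].
  exact: radial_intensity_ge0.
have oc k : (0 <= 1 - c k)%R by rewrite subr_ge0; have /andP[] := c01 k.
rewrite prod_expeRN; last by move=> k; rewrite mule_ge0// lee_fin.
congr (expeR (- _)).
have mdI k : measurable_fun setT (fun u : R =>
    (radial_density u)%:E * (\1_[set u | kappa u = k] u)%:E).
  apply: emeasurable_funM; apply/measurable_EFinP; last exact: measurable_indic.
  exact: measurable_radial_density.
have dI0 k (u : R) : 0 <= (radial_density u)%:E * (\1_[set u | kappa u = k] u)%:E.
  by rewrite -EFinM lee_fin mulr_ge0// radial_density_ge0.
transitivity (\int[lebesgue_measure]_u \sum_(k < K) (1 - c k)%:E *
    ((radial_density u)%:E * (\1_[set u | kappa u = k] u)%:E)).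
  rewrite ge0_integral_sum//; last 2 first.
  - by move=> k; apply: measurable_funeM; exact: mdI.
  - by move=> k u _; rewrite mule_ge0// lee_fin.
  apply: eq_bigr => k _; rewrite ge0_integralZl_EFin//.
    by rewrite -integral_radial_density.
  exact: mdI.
apply: eq_integral => u _; rewrite (bigD1 (kappa u))//= big1; last first.
  move=> k ku; rewrite indicE memNset ?mule0//= => ke.
  by rewrite ke eqxx in ku.
rewrite adde0 indicE mem_set// mule1 muleC; congr (_ * _).
(* [Q] is only a set function; its rule for complements is borrowed from the law of [W 0]. *)
rewrite -(W_distr 0); last exact: cyl_measC.
transitivity (1 - P (W 0 @^-1` L (kappa u))); first by rewrite W_distr// QE.
by rewrite -probability_setC//; exact: W_meas.
Qed.

End finite_types.
Section simple.
Variables (h : R -> R) (L : R -> set (S -> V)).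
Hypotheses (mh : measurable_fun setT h) (fin_h : finite_set (range h))
  (mL : forall r, cyl_meas (L r)).

Lemma measurable_marked_void_simple :
  measurable [set w | forall i, L (h (U i w)) (W i w)].
Proof.
have [K [kappa [v [mkappa vE]]]] := finite_range_index mh fin_h.
have := measurable_marked_void_finite mkappa (fun k => mL (v k)).
by under eq_set do under eq_forall do rewrite vE.
Qed.

Lemma marked_void_simple :
  P [set w | forall i, L (h (U i w)) (W i w)] =
  expeR (- \int[lebesgue_measure]_u
             ((radial_density u)%:E * Q (~` L (h u)))).
Proof.
have [K [kappa [v [mkappa vE]]]] := finite_range_index mh fin_h.
have := marked_void_finite mkappa (fun k => mL (v k)).
under eq_set do under eq_forall do rewrite vE.
by under eq_integral do rewrite vE.
Qed.

End simple.
End marked_poisson.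

(** * Void probability of the marked process *)

(** Order alone identifies the limit, also for [l = +oo]: writing [p = expeR y], each [lam m] is at
    most [- y], hence so is [l]; conversely every [expeR (- lam m)] is at least [expeR (- l)]. *)
Lemma expeRN_lim (R : realType) (lam : nat -> \bar R) (l p : \bar R) :
  (0 <= p)%E -> (forall m, lam m <= l)%E -> (lam m @[m --> \oo] --> l)%E ->
  (forall m, p <= expeR (- lam m))%E ->
  (expeR (- lam m) @[m --> \oo] --> p)%E -> p = expeR (- l)%E.
Proof.
move=> p0 laml caml ple pE; apply/eqP; rewrite eq_le; apply/andP; split.
  have [y yE] := expeR_total p0; rewrite -yE lee_expeR leeNr.
  rewrite -(cvg_lim (@ereal_hausdorff R) caml); apply: lime_le.
    by apply/cvg_ex; exists l.
  by apply: nearW => m; rewrite leeNr -lee_expeR yE.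
rewrite -(cvg_lim (@ereal_hausdorff R) pE); apply: lime_ge.
  by apply/cvg_ex; exists p.
by apply: nearW => m; rewrite lee_expeR leeN2.
Qed.

(** * Finite-valued approximation of the radii from below *)

Section dyadic.
Context (R : realType).

Import HBNNSimple.

Definition pos_approx (m : nat) (u : R) : R :=
  approx [set u : R | 0 < u] EFin m u.

Let mpos : measurable [set u : R | 0 < u].
Proof. by rewrite -set_itvoy; exact: measurable_itv. Qed.

Let mE : measurable_fun [set u : R | 0 < u] (EFin : R -> \bar R).
Proof. exact: EFin_measurable. Qed.

Lemma measurable_pos_approx m : measurable_fun setT (pos_approx m).
Proof.
rewrite (_ : pos_approx m = nnsfun_approx mpos mE m); last exact/esym/nnsfun_approxE.
exact: measurable_funPT.
Qed.

Lemma finite_range_pos_approx m : finite_set (range (pos_approx m)).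
Proof.
rewrite (_ : pos_approx m = nnsfun_approx mpos mE m); last exact/esym/nnsfun_approxE.
exact: fimfunP.
Qed.

Lemma pos_approx_homo u : {homo pos_approx ^~ u : m n / (m <= n)%N >-> m <= n}.
Proof. by move=> m n mn; apply/lefP : u; exact: nd_approx. Qed.

Lemma le_pos_approx m u : 0 < u -> pos_approx m u <= u.
Proof.
move=> u0; rewrite -lee_fin.
by apply: le_approx => // x x0; rewrite lee_fin ltW.
Qed.

Lemma pos_approx_cvg u : 0 < u -> pos_approx m u @[m --> \oo] --> u.
Proof.
move=> u0; apply: cvg_approx => //; last exact: ltry.
by move=> x x0; rewrite lee_fin ltW.
Qed.

End dyadic.

Section marked_void.
Local Open Scope ereal_scope.
Context (R : realType) (dT : measure_display) (T : measurableType dT)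
  (P : probability T R) (d : nat)
  (U : nat -> T -> R) (W : nat -> T -> 'rV[R]_d -> R)
  (Q : set ('rV[R]_d -> R) -> \bar R).
Hypotheses (U_PPP : is_PPP P (@measurable _ R) (@radial_intensity R) U)
  (U_pos : forall i w, (0 < U i w)%R)
  (W_pos : forall i w t, (0 < W i w t)%R)
  (W_meas : forall i L, cyl_meas L -> measurable (W i @^-1` L))
  (W_distr : forall i L, cyl_meas L -> P (W i @^-1` L) = Q L)
  (UW_indep : forall (n : nat) (L : 'I_n -> set ('rV[R]_d -> R)) (A : set (nat -> R)),
     (forall j, cyl_meas (L j)) -> cyl_meas A ->
     P ([set w | A (fun i => U i w)] `&`
        \bigcap_(j in [set: 'I_n]) [set w | L j (W j w)]) =
     P [set w | A (fun i => U i w)] * \prod_(j < n) P [set w | L j (W j w)]).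
Context (n : nat) (t : 'I_n -> 'rV[R]_d) (x : 'I_n -> \bar R).
Local Notation pe := (path_exceed t x).

Lemma path_exceed_homo (f : 'rV[R]_d -> R) (u v : R) : (forall s, 0 <= f s)%R ->
  (u <= v)%R -> pe u f -> pe v f.
Proof.
move=> f0 uv [j xj]; exists j; apply: lt_le_trans xj _.
by rewrite lee_fin ler_wpM2r.
Qed.

(** A strict inequality at the limit radius already holds at some approximation; the converse is
    monotonicity, for which [f] must be nonnegative. *)
Lemma path_exceed_approx (f : 'rV[R]_d -> R) (u : R) : (forall s, 0 <= f s)%R ->
  (0 < u)%R -> pe u f <-> exists m, pe (pos_approx m u) f.
Proof.
move=> f0 u0; split => [[j xj]|[m]]; last first.
  by apply: path_exceed_homo => //; exact: le_pos_approx.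
have : (pos_approx m u * f (t j))%:E @[m --> \oo] --> (u * f (t j))%:E.
  apply: cvg_EFin; first exact: nearW.
  by apply: cvgMl; exact: pos_approx_cvg.
move=> /(_ _ (open_ereal_gt_ereal xj))[m _ mx].
by exists m, j; exact: (mx m (leqnn m)).
Qed.

Let Q_ge0 L : cyl_meas L -> 0 <= Q L.
Proof. by move=> mL; rewrite -(W_distr 0)//; exact: measure_ge0. Qed.

Let W_ge0 i w s : (0 <= W i w s)%R.
Proof. exact: ltW. Qed.

Let marked m := [set w | forall i, ~ pe (pos_approx m (U i w)) (W i w)].

Let mpeC r : cyl_meas (~` pe r).
Proof. by apply: cyl_measC; exact: cyl_meas_path_exceed. Qed.

Let measurable_marked m : measurable (marked m).
Proof.
exact: (measurable_marked_void_simple U_PPP W_meas (@measurable_pos_approx R m)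
  (@finite_range_pos_approx R m) mpeC).
Qed.

Lemma marked_bigcap :
  [set w | forall i, ~ pe (U i w) (W i w)] = \bigcap_m marked m.
Proof.
apply/seteqP; split => w H.
  by move=> m _ i pem; apply: (H i); apply/path_exceed_approx => //; exists m.
by move=> i /path_exceed_approx[]// m; exact: (H m I i).
Qed.

Lemma measurable_marked_void :
  measurable [set w | forall i, ~ pe (U i w) (W i w)].
Proof. by rewrite marked_bigcap; exact: bigcapT_measurable. Qed.

Let Lam m := \int[lebesgue_measure]_v
  ((radial_density v)%:E * Q (pe (pos_approx m v))).

Let dens_ge0 (v : R) (r : R) : 0 <= (radial_density v)%:E * Q (pe r).
Proof.
rewrite mule_ge0 ?Q_ge0 ?lee_fin ?radial_density_ge0//.
exact: cyl_meas_path_exceed.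
Qed.

(** As the approximated radius takes finitely many values, its exceedance probability is a finite
    combination of indicators. Measurability for the exact radius follows later as a pointwise
    limit. *)
Let measurable_dens m : measurable_fun setT
  (fun v : R => (radial_density v)%:E * Q (pe (pos_approx m v))).
Proof.
apply: emeasurable_funM.
  by apply/measurable_EFinP; exact: measurable_radial_density.
have [K [kappa [v [mkappa vE]]]] :=
  finite_range_index (@measurable_pos_approx R m) (@finite_range_pos_approx R m).
rewrite (_ : (fun _ => _) = fun u =>
    \sum_(k < K) Q (pe (v k)) * (\1_[set u | kappa u = k] u)%:E).
  apply: emeasurable_sum => k; apply: measurable_funeM.
  by apply/measurable_EFinP; exact: measurable_indic.
apply/funext => u; rewrite (bigD1 (kappa u))//= indicE mem_set// mule1 vE.
rewrite big1 ?adde0// => k ku; rewrite indicE memNset ?mule0//= => ke.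
by rewrite ke eqxx in ku.
Qed.

Let measurable_Wpe r : measurable (W 0 @^-1` pe r).
Proof. by apply: W_meas; exact: cyl_meas_path_exceed. Qed.

Let Q_homo (m1 m2 : nat) v : (m1 <= m2)%N ->
  Q (pe (pos_approx m1 v)) <= Q (pe (pos_approx m2 v)).
Proof.
move=> m12; rewrite -!(W_distr 0); [|exact: cyl_meas_path_exceed..].
apply: le_measure; rewrite ?inE//.
by move=> w /=; apply: path_exceed_homo => //; exact: pos_approx_homo.
Qed.

Let Q_cvg v : (0 < v)%R -> Q (pe (pos_approx m v)) @[m --> \oo] --> Q (pe v).
Proof.
move=> v0; rewrite -(W_distr 0); last exact: cyl_meas_path_exceed.
rewrite (_ : (fun m => _) = P \o (fun m => W 0 @^-1` pe (pos_approx m v))); last first.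
  by apply/funext => m /=; rewrite (W_distr 0)//; exact: cyl_meas_path_exceed.
have -> : W 0 @^-1` pe v = \bigcup_m W 0 @^-1` pe (pos_approx m v).
  apply/seteqP; split => w /=; first by move=> /path_exceed_approx[]// m; exists m.
  by move=> [m _ pem]; apply/path_exceed_approx => //; exists m.
apply: nondecreasing_cvg_mu => //; first exact: bigcupT_measurable.
move=> m1 m2 m12; apply/subsetPset => w /=.
by apply: path_exceed_homo => //; exact: pos_approx_homo.
Qed.

(** The events [marked m] decrease to the void event while the exponents [Lam m] increase to the
    stated integral; [expeRN_lim] matches the two limits even if the exponent is infinite. *)
Lemma marked_void :
  P [set w | forall i, ~ pe (U i w) (W i w)] =
  expeR (- \int[lebesgue_measure]_v ((radial_density v)%:E * Q (pe v))).
Proof.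
have nd v : nondecreasing_seq
    (fun m => (radial_density v)%:E * Q (pe (pos_approx m v))).
  move=> m1 m2 m12; apply: lee_wpmul2l; first by rewrite lee_fin radial_density_ge0.
  exact: Q_homo.
have cv v : (radial_density v)%:E * Q (pe (pos_approx m v)) @[m --> \oo] -->
    (radial_density v)%:E * Q (pe v).
  have [v0|v0] := boolP (0 < v)%R; last first.
    rewrite /radial_density (negbTE v0) mul0e; under eq_fun do rewrite mul0e.
    exact: cvg_cst.
  by apply: cvgeZl => //; exact: Q_cvg.
have LamE : \int[lebesgue_measure]_v ((radial_density v)%:E * Q (pe v)) =
    \int[lebesgue_measure]_v limn (fun m =>
      (radial_density v)%:E * Q (pe (pos_approx m v))).
  by apply: eq_integral => v _; apply/esym/cvg_lim => //; exact: cv.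
have Lamcvg : Lam m @[m --> \oo] -->
    \int[lebesgue_measure]_v ((radial_density v)%:E * Q (pe v)).
  rewrite LamE; apply: cvg_monotone_convergence => //.
have markedE m : P (marked m) = expeR (- Lam m).
  have := marked_void_simple U_PPP W_meas W_distr UW_indep
    (@measurable_pos_approx R m) (@finite_range_pos_approx R m) mpeC.
  by under eq_integral do rewrite setCK.
apply: (@expeRN_lim _ Lam).
- exact: measure_ge0.
- move=> m; apply: ge0_le_integral => //.
  + exact: measurable_dens.
  + apply: (emeasurable_fun_cvg (fun m v =>
      (radial_density v)%:E * Q (pe (pos_approx m v)))).
      exact: measurable_dens.
    by move=> v _; exact: cv.
  + move=> v _; have [v0|v0] := boolP (0 < v)%R; last first.
      by rewrite /radial_density (negbTE v0) !mul0e.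
    apply: lee_wpmul2l; first by rewrite lee_fin radial_density_ge0.
    rewrite -!(W_distr 0); [|exact: cyl_meas_path_exceed..].
    apply: le_measure; rewrite ?inE//.
    by move=> w /=; apply: path_exceed_homo => //; exact: le_pos_approx.
- exact: Lamcvg.
- move=> m; rewrite -markedE; apply: le_measure; rewrite ?inE//.
    exact: measurable_marked_void.
  by rewrite marked_bigcap => w; exact.
- under eq_fun do rewrite -markedE.
  rewrite marked_bigcap; apply: nonincreasing_cvg_mu => //.
  + by apply: le_lt_trans (probability_le1 P (measurable_marked 0)) _; exact: ltry.
  + exact: bigcapT_measurable.
  + move=> m1 m2 m12; apply/subsetPset => w H i pem; apply: (H i).
    by apply: path_exceed_homo pem => //; exact: pos_approx_homo.
Qed.

End marked_void.

(** * Finite-dimensional laws *)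

Section finite_dimensional_laws.
Local Open Scope ereal_scope.
Context (R : realType).

(** Bounds in [\bar R] allow [+oo], which frees a coordinate: the family then contains the whole
    space and all one-coordinate rays, and is stable under intersection. *)
Definition lower_rays n : set (set ('I_n -> \bar R)) :=
  [set A | exists x : 'I_n -> \bar R, A = [set v | forall j, v j <= x j]].

Lemma measurable_cyl_lower_rays n :
  @measurable _ (cylType 'I_n (\bar R)) = <<s @lower_rays n >>.
Proof.
apply/seteqP; split.
  apply: smallest_sub; first exact: smallest_sigma_algebra.
  move=> _ [i [B [mB ->]]].
  pose M := g_sigma_algebraType (@lower_rays n).
  have mi : measurable_fun setT (fun v : M => v i : \bar R).
    apply: (measurability _ (ErealGenOInfty.measurableE R)) => //.
    move=> _ [_ [r ->]] <-; rewrite setTI -[X in measurable X]setCK.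
    apply: measurableC; apply: sub_sigma_algebra.
    exists (fun j => if j == i then r%:E else +oo).
    apply/seteqP; split => v /=; rewrite in_itv/= andbT.
      move=> /negP; rewrite -leNgt => vi j.
      by case: eqVneq => [->//|_]; exact: leey.
    by move=> /(_ i); rewrite eqxx leNgt => /negP.
  by have := mi measurableT _ mB; rewrite setTI.
apply: smallest_sub; first exact: smallest_sigma_algebra.
move=> _ [x ->].
have -> : [set v : 'I_n -> \bar R | forall j, v j <= x j] =
    ~` [set v : cylType 'I_n (\bar R) | exceeds x (fun j => v j)].
  apply/seteqP; split => v H; first by move=> [j]; rewrite ltNge H.
  by move=> j; rewrite leNgt; apply/negP => xj; apply: H; exists j.
apply: measurableC.
apply: (@measurable_exceeds R n _ (cylType 'I_n (\bar R)) x (fun j v => v j)) => j.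
exact: measurable_eval.
Qed.

Lemma lower_rays_setI n : setI_closed (@lower_rays n).
Proof.
move=> _ _ [x ->] [y ->]; exists (fun j => Order.min (x j) (y j)).
apply/seteqP; split => v /=; first by move=> [vx vy] j; rewrite le_min vx vy.
by move=> vxy; split=> j; have := vxy j; rewrite le_min => /andP[].
Qed.

(** Lower rays form a generating pi-system, so their preimages decide both measurability of the
    coordinate vectors and equality of their two laws. *)
Lemma same_fdd_lower_rays d
    d1 (T1 : measurableType d1) (P1 : probability T1 R) (X1 : T1 -> 'rV[R]_d -> \bar R)
    d2 (T2 : measurableType d2) (P2 : probability T2 R) (X2 : T2 -> 'rV[R]_d -> \bar R) :
  (forall n (t : 'I_n -> 'rV[R]_d) (x : 'I_n -> \bar R),
     [/\ measurable [set w | forall j, X1 w (t j) <= x j],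
         measurable [set w | forall j, X2 w (t j) <= x j] &
         P1 [set w | forall j, X1 w (t j) <= x j] =
         P2 [set w | forall j, X2 w (t j) <= x j]]) ->
  same_fdd P1 X1 P2 X2.
Proof.
move=> H n t B mB.
pose V := cylType 'I_n (\bar R).
pose Y1 w : V := fun j => X1 w (t j).
pose Y2 w : V := fun j => X2 w (t j).
have mY1 : measurable_fun setT Y1.
  apply: (measurability _ (@measurable_cyl_lower_rays n)) => _ [_ [x ->] <-].
  by rewrite setTI; have [] := H n t x.
have mY2 : measurable_fun setT Y2.
  apply: (measurability _ (@measurable_cyl_lower_rays n)) => _ [_ [x ->] <-].
  by rewrite setTI; have [] := H n t x.
pose m1 : {measure set V -> \bar R} := pushforward P1 Y1.
pose m2 : {measure set V -> \bar R} := pushforward P2 Y2.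
have rT : lower_rays [set: V].
  by exists (fun=> +oo); apply/seteqP; split => v // _ j; rewrite leey.
apply: (@measure_unique _ R V (@lower_rays n) (fun=> setT)
  (@measurable_cyl_lower_rays n) (@lower_rays_setI n) _ _ (m1 mY1) (m2 mY2)) => //.
- by rewrite bigcup_const.
- by move=> _ [x ->]; have [] := H n t x.
- move=> _; apply: le_lt_trans (probability_le1 P1 measurableT) _; exact: ltry.
Qed.

End finite_dimensional_laws.

Lemma ereal_sup_range_le (R : realType) (a : nat -> \bar R) (x : \bar R) :
  (ereal_sup (range a) <= x)%E <-> (forall i, a i <= x)%E.
Proof.
split => [ax i|ax]; last by apply: ge_ereal_sup => _ [i _ <-].
by apply: le_trans ax; apply: ereal_sup_ubound; exists i.
Qed.

Lemma mixed_max_le (R : realType) (d : nat) (T : Type)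
    (X : nat -> T -> R * 'rV[R]_d * ('rV[R]_d -> R)) n (t : 'I_n -> 'rV[R]_d)
    (x : 'I_n -> \bar R) :
  (forall i w, continuous (X i w).2) ->
  [set w | forall j, mixed_max X w (t j) <= x j]%E =
  [set w | forall i, ~ mark_exceed t x (X i w)].
Proof.
move=> cX; apply/seteqP; split => w H.
  move=> i; rewrite (surjective_pairing (X i w)).
  rewrite (surjective_pairing (X i w).1) mark_exceedE// => -[j].
  by rewrite ltNge; have /ereal_sup_range_le/(_ i) -> := H j.
move=> j; apply/ereal_sup_range_le => i; rewrite leNgt; apply/negP => xj.
apply: (H i); rewrite (surjective_pairing (X i w)).
by rewrite (surjective_pairing (X i w).1) mark_exceedE//; exists j.
Qed.

Lemma incr_max_le (R : realType) (d : nat) (T : Type) (U : nat -> T -> R)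
    (W : nat -> T -> 'rV[R]_d -> R) n (t : 'I_n -> 'rV[R]_d) (x : 'I_n -> \bar R) :
  [set w | forall j, incr_max U W w (t j) <= x j]%E =
  [set w | forall i, ~ path_exceed t x (U i w) (W i w)].
Proof.
apply/seteqP; split => w H.
  by move=> i [j]; rewrite ltNge; have /ereal_sup_range_le/(_ i) -> := H j.
move=> j; apply/ereal_sup_range_le => i; rewrite leNgt; apply/negP => xj.
by apply: (H i); exists j.
Qed.

Lemma mark_intensity_ge0 (R : realType) (d : nat) (d0 : measure_display)
    (T : measurableType d0) (P : probability T R) (F : T -> 'rV[R]_d -> R) A :
  (0 <= mark_intensity P F A)%E.
Proof.
apply: integral_ge0 => u _; apply: mule_ge0.
  by rewrite lee_fin invr_ge0 sqr_ge0.
by apply: iter_int_ge0 => v; apply: integral_ge0 => w _; rewrite lee_fin.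
Qed.

Theorem theorem4p1 (R : realType) (d : nat)
  (d0 : measure_display) (Om : measurableType d0) (P : probability Om R)
  (F : Om -> 'rV[R]_d -> R)
  (F_meas : forall t, measurable_fun [set: Om] (fun w => F w t))
  (F_cont : forall w, continuous (F w))
  (F_pos : forall w t, 0 < F w t)
  (F_int : (\int[P]_w int_Rd (fun t => (F w t)%:E) = 1)%E)
  (X : nat -> Om -> R * 'rV[R]_d * ('rV[R]_d -> R))
  (X_dom : forall i w, 0 < (X i w).1.1 /\ continuous (X i w).2 /\
                       (forall t, 0 <= (X i w).2 t))
  (X_PPP : is_PPP P (@mark_meas R d) (mark_intensity P F) X) :
  W_law P F [set f : 'rV[R]_d -> R | f (0 : 'rV[R]_d) = 1] = 1%E /\
  forall (d1 : measure_display) (Om' : measurableType d1) (P' : probability Om' R)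
    (U' : nat -> Om' -> R) (W : nat -> Om' -> 'rV[R]_d -> R),
    (forall i w, 0 < U' i w) ->
    is_PPP P' (@measurable _ R) (@radial_intensity R) U' ->
    (forall i w, continuous (W i w) /\ forall t, 0 < W i w t) ->
    (forall i L, cyl_meas L -> measurable (W i @^-1` L)) ->
    (forall i L, cyl_meas L -> P' (W i @^-1` L) = W_law P F L) ->
    (forall (n : nat) (L : 'I_n -> set ('rV[R]_d -> R)) (A : set (nat -> R)),
       (forall j, cyl_meas (L j)) -> cyl_meas A ->
       P' ([set w | A (fun i => U' i w)] `&`
           \bigcap_(j in [set: 'I_n]) [set w | L j (W j w)]) =
       (P' [set w | A (fun i => U' i w)] *
        \prod_(j < n) P' [set w | L j (W j w)])%E) ->
    same_fdd P (mixed_max X) P' (incr_max U' W).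
Proof.
split; first exact: W_law_normalized.
move=> d1 Om' P' U' W U'_pos U'_PPP W_dom W_meas W_lawE UW_indep.
have W_pos i w t : 0 < W i w t by case: (W_dom i w).
have X_cont i w : continuous (X i w).2 by have [_ []] := X_dom i w.
apply: same_fdd_lower_rays => n t x.
have mA := @mark_meas_mark_exceed R d n t x.
have PX : P [set w | forall j, (mixed_max X w (t j) <= x j)%E] =
    expeR (- mark_intensity P F (mark_exceed t x)).
  rewrite mixed_max_le//; apply: (PPP_void X_PPP) => // A _.
  exact: mark_intensity_ge0.
rewrite PX mark_intensity_exceed// mixed_max_le// !incr_max_le.
split.
- have [mX _ _ _] := X_PPP.
  rewrite (_ : mkset _ = \bigcap_i ~` (X i @^-1` mark_exceed t x)).
    by apply: bigcapT_measurable => i; apply: measurableC; exact: mX.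
  by apply/seteqP; split => w H i; [move=> _|]; exact: H.
- exact: (measurable_marked_void U'_PPP U'_pos W_pos W_meas).
- by rewrite (marked_void U'_PPP U'_pos W_pos W_meas W_lawE UW_indep).
Qed.
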